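(* Let $(X,\Vert\cdot\Vert)$ be a normed space and let $G\subseteq\mathcal{L}(X)$ be a compact topological group of isometries acting on $X$. Then $X_G$ is a Banach space if and only if for every $f\colon X\to\mathbb{R}$ that is bounded below, Lipschitz continuous, $G$-invariant and convex with respect to $G$, and for every $\epsilon>0$, there exists $x_0\in X_G$ such that \[ f(x_0)\le\inf_X f+\epsilon \] and \[ f(x_0)\le f(x)+\epsilon\Vert x-x_0\Vert\quad\text{for all } x\in X,\ x\neq x_0. \]
   Context: $\mathcal{L}(X)$ is the space of continuous linear maps $X\to X$ with the operator norm topology; $G\subseteq \mathcal{L}(X)$ is a group (under composition) of invertible bounded linear maps with the relative topology, and $\mu$ is the normalized Haar measure on the compact group $G$. $X_G=\{x\in X\mid g(x)=x\ \forall g\in G\}$, with the norm of $X$. A function $f$ on $X$ is $G$-invariant if $f(g(x))=f(x)$ for all $x\in X$, $g\in G$. For $x\in X$, $\overline{x}=\int_G g(x)\,d\mu(g)$ (Bochner integral), regarded as a point of $X$; $f$ is convex with respect to $G$ if $f(\overline{x})\le\int_G f(g(x))\,d\mu(g)$ for all $x\in X$. *)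

(* Defs.v *)
From HB Require Import structures.
From mathcomp Require Import all_boot all_order all_algebra.
From mathcomp Require Import all_classical all_reals all_analysis.
Set Implicit Arguments.
Unset Strict Implicit.
Unset Printing Implicit Defensive.
Import Order.TTheory GRing.Theory Num.Theory.
Import numFieldNormedType.Exports.
Local Open Scope classical_set_scope.
Local Open Scope ring_scope.

Section ContinuousLinear.
Context {R : realType} {X : normedModType R}.

Definition continuous_linear_pred : {pred X -> X} :=
  fun f => `[< linear f /\ continuous f >].

Lemma continuous_linear_submod_closed : submod_closed continuous_linear_pred.
Proof.
split.
  apply/asboolP; split=> [a u v|].
    by rewrite [RHS](_ : _ = a *: 0 + 0)// scaler0 addr0.
  exact: cst_continuous.
move=> a f g /asboolP[lf cf] /asboolP[lg cg]; apply/asboolP; split.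
  move=> b u v; change (a *: f (b *: u + v) + g (b *: u + v) =
    b *: (a *: f u + g u) + (a *: f v + g v)).
  by rewrite lf lg !scalerDr !scalerA addrACA [a * b]mulrC.
move=> x; apply: cvgD; last exact: cg.
by apply: cvgZl_tmp; exact: cf.
Qed.

HB.instance Definition _ := GRing.isSubmodClosed.Build R (X -> X)
  continuous_linear_pred continuous_linear_submod_closed.

Record continuous_linear : Type := ContinuousLinear {
  clin_fun :> X -> X;
  clin_funP : clin_fun \in continuous_linear_pred }.

HB.instance Definition _ := [isSub for clin_fun].
HB.instance Definition _ := [Choice of continuous_linear by <:].
HB.instance Definition _ := [SubChoice_isSubLmodule of continuous_linear by <:].

Implicit Types T S : continuous_linear.

Lemma clin_linear T : linear T.
Proof. by have /asboolP[] := clin_funP T. Qed.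

Lemma clin_continuous T : continuous T.
Proof. by have /asboolP[] := clin_funP T. Qed.

HB.instance Definition _ T := GRing.isLinear.Build R X X _ T (clin_linear T).

Definition opnorm T : R := sup [set `|T x| | x in [set x : X | `|x| <= 1]].

Lemma opnorm_has_sup T :
  has_sup [set `|T x| | x in [set x : X | `|x| <= 1]].
Proof.
split; first by exists `|T 0|, 0 => //=; rewrite normr0.
have /linear_boundedP[M [_ TM]] :
    bounded_near T (nbhs (0 : X)) by apply/linear_bounded_continuous/clin_continuous.
exists (`|M| + 1) => _ [x /= x1 <-].
have M1 : M < `|M| + 1 by rewrite (le_lt_trans (ler_norm _)) ?ltrDl.
by rewrite (le_trans (TM _ M1 x))// ler_piMr ?addr_ge0.
Qed.

Lemma le_opnorm T (x : X) : `|T x| <= opnorm T * `|x|.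
Proof.
have [->|x0] := eqVneq x 0; first by rewrite linear0 !normr0 mulr0.
have nx0 : 0 < `|x| by rewrite normr_gt0.
rewrite -ler_pdivrMr//.
have -> : `|T x| / `|x| = `|T (`|x|^-1 *: x)|.
  by rewrite linearZ/= normrZ ger0_norm ?invr_ge0// mulrC.
apply: ub_le_sup; first by have [] := opnorm_has_sup T.
by exists (`|x|^-1 *: x) => //=; rewrite normrZ ger0_norm ?invr_ge0// mulVf// gt_eqF.
Qed.

Lemma opnorm_ge0 T : 0 <= opnorm T.
Proof.
apply: (@le_trans _ _ `|T 0|) => //.
apply: ub_le_sup; first by have [] := opnorm_has_sup T.
by exists 0 => //=; rewrite normr0.
Qed.

Lemma opnorm_le T (c : R) :
  (forall x : X, `|x| <= 1 -> `|T x| <= c) -> opnorm T <= c.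
Proof.
move=> Tc; apply: ge_sup; first by have [] := opnorm_has_sup T.
by move=> _ [x /= x1 <-]; exact: Tc.
Qed.

Lemma ler_opnormD T S : opnorm (T + S) <= opnorm T + opnorm S.
Proof.
apply: opnorm_le => x x1; rewrite (le_trans (ler_normD _ _))//.
have h (U : continuous_linear) : `|U x| <= opnorm U.
  by rewrite (le_trans (le_opnorm U x))// ler_piMr// opnorm_ge0.
by rewrite lerD.
Qed.

Lemma opnormZ_le (a : R) T : opnorm (a *: T) <= `|a| * opnorm T.
Proof.
apply: opnorm_le => x x1.
rewrite [X in `|X|](_ : _ = a *: T x)// normrZ ler_wpM2l//.
by rewrite (le_trans (le_opnorm T x))// ler_piMr// opnorm_ge0.
Qed.

Lemma opnormZ (a : R) T : opnorm (a *: T) = `|a| * opnorm T.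
Proof.
apply/eqP; rewrite eq_le opnormZ_le/=.
have [->|a0] := eqVneq a 0; first by rewrite normr0 mul0r opnorm_ge0.
rewrite -ler_pdivlMl ?normr_gt0//.
rewrite -normfV (le_trans _ (opnormZ_le a^-1 (a *: T)))//.
by rewrite scalerA mulVf// scale1r.
Qed.

Lemma opnorm0_eq0 T : opnorm T = 0 -> T = 0.
Proof.
move=> T0; apply/val_inj/funext => x /=; apply/eqP; rewrite -normr_le0.
by rewrite (le_trans (le_opnorm T x))// T0 mul0r.
Qed.

HB.instance Definition _ := Lmodule_isNormed.Build R continuous_linear
  ler_opnormD opnormZ opnorm0_eq0.

(* the Borel sigma-algebra of the operator norm topology *)
HB.instance Definition _ := @isMeasurable.Build
  (sigma_display (@open continuous_linear))
  continuous_linear <<s @open continuous_linear >>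
  (@sigma_algebra0 _ setT _) (@sigma_algebraC _ _)
  (@sigma_algebra_bigcup _ setT _).

Lemma clin_id_subproof : (@idfun X) \in continuous_linear_pred.
Proof. by apply/asboolP; split=> // x; exact: cvg_id. Qed.

Definition clin_id := ContinuousLinear clin_id_subproof.

Lemma clin_comp_subproof T S : (T \o S) \in continuous_linear_pred.
Proof.
apply/asboolP; split; first by move=> a u v; rewrite /= !linearP.
by move=> x; apply: continuous_comp; exact: clin_continuous.
Qed.

Definition clin_comp T S := ContinuousLinear (clin_comp_subproof T S).

End ContinuousLinear.
Arguments continuous_linear {R} X.
Arguments clin_id {R X}.
Notation "''L' ( X )" := (continuous_linear X)
  (at level 8, format "''L' ( X )") : type_scope.

(* For isometries composition and inversion are automatically continuous in the
   operator norm, since g h - g' h' = g (h - h') + (g - g') h' and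
   g^-1 - h^-1 = g^-1 (h - g) h^-1; such a G is thus a topological group for the
   relative topology without any further hypothesis. *)
Record isometry_group {R : realType} {X : normedModType R} (G : set 'L(X)) : Prop := {
  isometry_group_id : G clin_id;
  isometry_group_comp : forall g h, G g -> G h -> G (clin_comp g h);
  isometry_group_inv : forall g, G g ->
    exists h, [/\ G h, clin_comp g h = clin_id & clin_comp h g = clin_id];
  isometry_group_dist : forall g, G g -> forall x y : X, `|g x - g y| = `|x - y| }.

(* A measure on G is represented by a measure on L(X) of which only the values
   on subsets of G are used (a compact G is closed, hence a Borel set).
   Regularity need not be required: every finite Borel measure on a compact
   metric space is regular. *)
Definition normalized_haar {R : realType} {X : normedModType R} (G : set 'L(X))
    (mu : {measure set 'L(X) -> \bar R}) : Prop :=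
  mu G = 1%E /\
  forall (g : 'L(X)) (A : set 'L(X)), G g -> measurable A -> A `<=` G ->
    mu (clin_comp g @` A) = mu A.

Section Bochner.
Context {d : measure_display} {T : measurableType d} {R : realType}
        {X : normedModType R}.
Variables (mu : {measure set T -> \bar R}) (D : set T).

Definition simple_function (s : T -> X) : Prop :=
  finite_set (range s) /\ forall v, measurable (s @^-1` [set v]).

Definition simple_integral (s : T -> X) : X :=
  \sum_(v \in range s) fine (mu (D `&` s @^-1` [set v])) *: v.

(* Meant for mu D < +oo.  X need not be complete; since X is dense in its
   completion, this says that the Bochner integral of f in the completion of X
   is the point y of X. *)
Definition is_bochner_integral (f : T -> X) (y : X) : Prop :=
  exists s : nat -> T -> X,
    [/\ forall n, simple_function (s n),
        forall n, measurable_fun D (fun t => `|f t - s n t|),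
        (\int[mu]_(t in D) `|f t - s n t|%:E)%E @[n --> \oo] --> 0%E &
        simple_integral (s n) @[n --> \oo] --> y].

Definition bochner_integral (f : T -> X) : X := get (is_bochner_integral f).

End Bochner.

Section GroupInvariance.
Context {R : realType} {X : normedModType R}.
Variable G : set 'L(X).

Definition fixed_pred : {pred X} :=
  fun x => `[< forall g, G g -> g x = x >].

Lemma fixed_submod_closed : submod_closed fixed_pred.
Proof.
split; first by apply/asboolP => g _; rewrite linear0.
move=> a x y /asboolP xG /asboolP yG; apply/asboolP => g Gg.
by rewrite clin_linear xG// yG.
Qed.

HB.instance Definition _ := GRing.isSubmodClosed.Build R X fixed_pred
  fixed_submod_closed.

Record fixed_space : Type := FixedSpace {
  fixed_val :> X;
  fixed_valP : fixed_val \in fixed_pred }.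

HB.instance Definition _ := [isSub for fixed_val].
HB.instance Definition _ := [Choice of fixed_space by <:].
HB.instance Definition _ := [SubChoice_isSubLmodule of fixed_space by <:].

Definition fixed_norm (x : fixed_space) : R := `|fixed_val x|.

Lemma ler_fixed_normD x y : fixed_norm (x + y) <= fixed_norm x + fixed_norm y.
Proof. exact: ler_normD. Qed.

Lemma fixed_normZ (a : R) x : fixed_norm (a *: x) = `|a| * fixed_norm x.
Proof. exact: normrZ. Qed.

Lemma fixed_norm0_eq0 x : fixed_norm x = 0 -> x = 0.
Proof. by move=> /normr0_eq0 x0; exact: val_inj. Qed.

HB.instance Definition _ := Lmodule_isNormed.Build R fixed_space
  ler_fixed_normD fixed_normZ fixed_norm0_eq0.

Definition invariant_under (f : X -> R) : Prop :=
  forall g x, G g -> f (g x) = f x.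

Variable mu : {measure set 'L(X) -> \bar R}.

(* [get] in bochner_integral never falls back on its default value here when G
   is a compact group of isometries and mu its Haar measure: by Peter-Weyl there
   is F in a finite-dimensional translation-invariant space of continuous
   functions on G such that the integral of F(g) g is close to the identity;
   hence G spans a finite-dimensional subspace of L(X), and the average of x,
   a limit of elements of the span of its orbit, lies in X even if X is not
   complete. *)
Definition group_average (x : X) : X :=
  bochner_integral mu G (fun g : 'L(X) => g x).

Definition convex_wrt (f : X -> R) : Prop :=
  forall x, f (group_average x) <= \int[mu]_(g in G) f (g x).

End GroupInvariance.

Definition banach {R : realType} (V : normedModType R) : Prop :=
  forall F : set_system V, ProperFilter F -> cauchy F -> cvg F.

(* Main.v *)
Require Import Defs.
From HB Require Import structures.
From mathcomp Require Import all_boot all_order all_algebra.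
From mathcomp Require Import all_classical all_reals all_analysis.
From mathcomp Require Import finmap measurable_realfun ring lra.
Import Order.TTheory GRing.Theory Num.Theory.
Import numFieldNormedType.Exports.
Local Open Scope classical_set_scope.
Local Open Scope ring_scope.

(* The average [m x] of the orbit of [x] lies in X_G, and it satisfies
   |m x - z| <= |x - z| for every z in X_G. Hence, if X_G is complete, a point
   given by Ekeland's principle for the restriction of f to X_G is good for f on
   X, since f (m x) <= f x. Conversely, if F is a Cauchy filter on X_G, the
   property for f x = lim_(y -> F) |x - y| and eps = 1/2 gives x0 with
   f x0 <= f x0 / 2, that is, a limit of F.

   As X is not complete, the existence of the average is the main point: G spans
   a finite-dimensional subspace of L(X). Let T average bounded functionals phi
   on L(X) by right translations close to the identity. On G it is the integral
   operator with kernel kappa (|g - h|), which is symmetric, so T is self-adjoint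
   in L^2(mu), while |phi - T phi| <= eps |phi| in the dual norm. By
   Cauchy-Schwarz the norms |(1 - T)^n phi|_2 are log-convex in n, and they are
   O(eps^n), so |phi - T phi|_2 <= eps |phi|_2 as well. If T phi vanishes on a
   fine finite net of G then also |T phi|_2 <= eps |phi|_2, whence phi = 0 on G.
   Thus finitely many linear conditions force phi = 0 on G, and by Hahn-Banach
   finitely many elements of G span the others. *)

(** * Hahn-Banach theorem *)

Section HahnBanach.
Context {R : realType} {V : lmodType R}.
Implicit Types (p q : V -> R) (x y : V).

Definition sublinear p :=
  (forall x y, p (x + y) <= p x + p y) /\
  (forall a x, 0 <= a -> p (a *: x) = a * p x).

Lemma sublinear0 {p} : sublinear p -> p 0 = 0.
Proof. by move=> [_ h]; rewrite -(scale0r 0) h// mul0r. Qed.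

Lemma sublinear_geN {p} : sublinear p -> forall x, - p (- x) <= p x.
Proof.
move=> hp x; have := hp.1 x (- x); rewrite subrr (sublinear0 hp) => h; lra.
Qed.

(** Homogeneity as an inequality suffices: applying it to [a^-1] and [a *: x] gives the converse.
    This form suits functionals defined as infima. *)
Lemma sublinear_le p : p 0 <= 0 -> (forall x y, p (x + y) <= p x + p y) ->
  (forall a x, 0 < a -> p (a *: x) <= a * p x) -> sublinear p.
Proof.
move=> p0 pD pZ; split=> // a x; rewrite le_eqVlt => /predU1P[<-|a0].
  rewrite scale0r mul0r; apply/eqP; rewrite eq_le p0.
  by have := pD 0 0; rewrite addr0 => ?; lra.
apply/eqP; rewrite eq_le pZ//= -ler_pdivlMl//.
have := pZ a^-1 (a *: x); rewrite scalerA mulVf ?gt_eqF// scale1r; apply.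
by rewrite invr_gt0.
Qed.

Lemma le_infD (A B : set R) (c : R) : A !=set0 -> B !=set0 ->
  (forall a b, A a -> B b -> c <= a + b) -> c <= inf A + inf B.
Proof.
move=> A0 B0 h; rewrite -lerBlDr; apply: lb_le_inf => // a Aa.
rewrite lerBlDr -lerBlDl; apply: lb_le_inf => // b Bb.
by rewrite lerBlDl; exact: h.
Qed.

(* A minimal sublinear functional is linear because sliding it along [y] cannot
   lower it. *)
Definition slide p y x := inf [set p (x + t *: y) - t * p y | t in [set t | 0 <= t]].

Lemma slide_nonempty p y x :
  [set p (x + t *: y) - t * p y | t in [set t | 0 <= t]] !=set0.
Proof. by exists (p (x + 0 *: y) - 0 * p y), 0 => /=. Qed.

Lemma slide_le p y x t : sublinear p -> 0 <= t ->
  slide p y x <= p (x + t *: y) - t * p y.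
Proof.
move=> hp t0; apply: ge_inf; last by exists t.
(* Subadditivity at [x + s *: y] and [- x] gives a lower bound independent of [s]. *)
exists (- p (- x)) => _ [s /= s0 <-].
have := hp.1 (x + s *: y) (- x).
by rewrite addrAC subrr add0r hp.2// => h; lra.
Qed.

Lemma slide_le_self p y x : sublinear p -> slide p y x <= p x.
Proof.
by move=> hp; rewrite (le_trans (slide_le _ _ _ 0 hp _))// scale0r addr0 mul0r subr0.
Qed.

Lemma slideN p y : sublinear p -> slide p y (- y) <= - p y.
Proof.
move=> hp; rewrite (le_trans (slide_le _ _ _ 1 hp _))//.
by rewrite scale1r addNr (sublinear0 hp) mul1r sub0r.
Qed.

Lemma slide_sublinear p y : sublinear p -> sublinear (slide p y).
Proof.
move=> hp; apply: sublinear_le.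
- by rewrite (le_trans (slide_le_self _ _ _ hp))// (sublinear0 hp).
- move=> x x'; apply: le_infD; [exact: slide_nonempty..|].
  move=> _ _ [t /= t0 <-] [s /= s0 <-].
  rewrite (le_trans (slide_le _ _ _ (t + s) hp _)) ?addr_ge0//.
  rewrite scalerDl addrACA; have := hp.1 (x + t *: y) (x' + s *: y) => h; lra.
- move=> a x a0; rewrite -ler_pdivrMl//.
  apply: lb_le_inf; first exact: slide_nonempty.
  move=> _ [t /= t0 <-]; rewrite ler_pdivrMl//.
  rewrite (le_trans (slide_le _ _ _ (a * t) hp _)) ?mulr_ge0 ?(ltW a0)//.
  by rewrite -scalerA -scalerDr hp.2 ?(ltW a0)// mulrBr mulrA.
Qed.

(** Zorn's lemma for the reversed pointwise order on the sublinear functionals below [p]. A nonempty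
    chain is bounded by its pointwise infimum, which is finite since [- p (- x)] lies below the
    value of every member at [x]. *)
Lemma minimal_sublinear p : sublinear p ->
  exists m, [/\ sublinear m, forall x, m x <= p x &
    forall q, sublinear q -> (forall x, q x <= m x) -> q = m].
Proof.
move=> hp; pose T := {q : V -> R | sublinear q /\ forall x, q x <= p x}.
pose r (q q' : T) := `[< forall x, sval q' x <= sval q x >].
have [|||A Atot|[m [hm mp]] mmin] := @Zorn T r.
- by move=> q; apply/asboolP.
- move=> a b c /asboolP ab /asboolP bc; apply/asboolP => x.
  exact: le_trans (bc x) (ab x).
- move=> [a ha] [b hb] /asboolP/= ab /asboolP/= ba; apply: eq_exist.
  by apply/funext => x; apply/eqP; rewrite eq_le ab ba.
- have [[a0 Aa0]|A0] := pselect (A !=set0); last first.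
    exists (exist _ p (conj hp (fun=> lexx _))) => s As.
    by exfalso; apply: A0; exists s.
  pose S x := [set sval a x | a in A].
  have S0 x : S x !=set0 by exists (sval a0 x), a0.
  have Slb x : has_lbound (S x).
    exists (- p (- x)) => _ [a Aa <-]; case: a {Aa} => a [ha ap] /=.
    by rewrite (le_trans _ (sublinear_geN ha x))// lerN2.
  have qle (a : T) x : A a -> inf (S x) <= sval a x.
    by move=> Aa; apply: ge_inf => //; exists a.
  have hq : sublinear (fun x => inf (S x)).
    apply: sublinear_le.
    - by rewrite (le_trans (qle _ _ Aa0))// (sublinear0 (svalP a0).1).
    - move=> x y; apply: le_infD => // _ _ [a Aa <-] [b Ab <-].
      (* The smaller of the two members of the chain serves at both points. *)
      have [/asboolP ab|/asboolP ba] := Atot _ _ Aa Ab.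
        by rewrite (le_trans (qle _ _ Ab))// (le_trans ((svalP b).1.1 _ _))// lerD2r.
      by rewrite (le_trans (qle _ _ Aa))// (le_trans ((svalP a).1.1 _ _))// lerD2l.
    - move=> a x ap; rewrite -ler_pdivrMl//; apply: lb_le_inf => // _ [b Ab <-].
      by rewrite ler_pdivrMl// -(svalP b).1.2 ?(ltW ap)//; exact: qle.
  have qp x : inf (S x) <= p x by rewrite (le_trans (qle _ _ Aa0))// (svalP a0).2.
  exists (exist _ (fun x => inf (S x)) (conj hq qp) : T) => s As.
  by apply/asboolP => x; exact: qle.
exists m; split=> // q hq qm.
have qp x : q x <= p x by rewrite (le_trans (qm x)).
have /(congr1 sval) //: exist _ q (conj hq qp) = exist _ m (conj hm mp) :> T.
by apply: mmin; apply/asboolP.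
Qed.

(** A minimal [m] below [slide p y] coincides with every [slide m x], so [slideN] makes it odd,
    hence additive. Starting from [slide p y] rather than [p] gives [m (- y) <= - p y], whence
    [m y = p y]. *)
Lemma hahn_banach p y : sublinear p ->
  exists phi : V -> R, [/\ scalar phi, forall x, phi x <= p x & phi y = p y].
Proof.
move=> hp.
have [m [hm mp mmin]] := minimal_sublinear _ (slide_sublinear p y hp).
have {}mp x : m x <= p x /\ (x = - y -> m x <= - p y).
  split; first by rewrite (le_trans (mp x))// slide_le_self.
  by move=> ->; rewrite (le_trans (mp _))// slideN.
have mN x : m (- x) = - m x.
  have := slideN m x hm; rewrite (mmin (slide m x)); first last.
  - by move=> z; exact: slide_le_self.
  - exact: slide_sublinear.
  by move=> h; apply/eqP; rewrite eq_le h/= lerNl (sublinear_geN hm).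
have mD x z : m (x + z) = m x + m z.
  apply/eqP; rewrite eq_le hm.1/=.
  by have := hm.1 (- x) (- z); rewrite -opprD !mN => h; lra.
have mZ a x : m (a *: x) = a * m x.
  have [a0|a0] := leP 0 a; first by rewrite hm.2.
  by rewrite -[a *: x]opprK -scaleNr mN hm.2 ?mulNr ?opprK// oppr_ge0 ltW.
exists m; split=> [a u v|x|]; first by rewrite mD mZ.
  exact: (mp x).1.
apply/eqP; rewrite eq_le (mp y).1/=.
by have := (mp (- y)).2 erefl; rewrite mN lerN2.
Qed.

End HahnBanach.

(** * Linear spans of finite families *)

(** Gaussian elimination: if some [c0] in [Phi] is nonzero at [g0], one condition can be eliminated
    on the functions vanishing at [g0]. In this way abstract linear conditions are exchanged for
    evaluations at points of [G]. *)
Lemma finite_determination {R : fieldType} {T : Type} (G : set T) (r : nat)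
    (Phi : set (T -> R)) (E : nat -> (T -> R) -> R) :
  (forall c d a, Phi c -> Phi d -> Phi (fun t => c t - a * d t)) ->
  (forall j c d a, Phi c -> Phi d ->
    E j (fun t => c t - a * d t) = E j c - a * E j d) ->
  (forall c, Phi c -> (forall j, (j < r)%N -> E j c = 0) ->
    forall t, G t -> c t = 0) ->
  exists L : seq T, (forall t, List.In t L -> G t) /\
    forall c, Phi c -> (forall t, List.In t L -> c t = 0) ->
    forall t, G t -> c t = 0.
Proof.
elim: r Phi E => [|r IH] Phi E PhiB EB Einj.
  by exists [::]; split=> // c Phic _; exact: Einj.
have [[c0 [g0 [Phic0 Gg0 c0g0]]]|allzero] :=
    pselect (exists c g, [/\ Phi c, G g & c g <> 0]); last first.
  exists [::]; split=> // c Phic _ t Gt; apply: contrapT => ct.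
  by apply: allzero; exists c, t.
have [k kr Ek] : exists2 k, (k < r.+1)%N & E k c0 <> 0.
  apply: contrapT => nE; apply: c0g0; apply: Einj => // j jr.
  by apply: contrapT => Ej; apply: nE; exists j.
(* For [j < r], [s] runs through the indices up to [r] other than [k]; the correction in [E'] makes
   each [E' j] vanish at [c0]. *)
pose s j := if j == k then r else j.
pose E' j c := E (s j) c - E (s j) c0 / E k c0 * E k c.
have [||c [Phic cg0] E'c t Gt|L [LG Linj]] :=
    IH [set c | Phi c /\ c g0 = 0] E'.
- by move=> c d a [Pc c0'] [Pd d0]; split; [exact: PhiB|rewrite c0' d0 mulr0 subr0].
- by move=> j c d a [Pc _] [Pd _]; rewrite /E' !EB//; ring.
(* All the conditions vanish on [c - a * c0], so this function is zero on [G]; at [g0], where [c]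
   vanishes and [c0] does not, this gives [a = 0]. *)
- pose a := E k c / E k c0.
  have Ek' : E k c0 != 0 by exact/eqP.
  have ca t' : G t' -> c t' - a * c0 t' = 0.
    apply: (Einj (fun t => c t - a * c0 t)) => [|j jr]; first exact: PhiB.
    rewrite EB// /a; have [->|jk] := eqVneq j k; first by rewrite divfK// subrr.
    have [i [ir si]] : exists i, (i < r)%N /\ s i = j.
      move: jr; rewrite ltnS leq_eqVlt => /predU1P[jr|jr]; last first.
        by exists j; rewrite /s (negbTE jk).
      exists k; rewrite /s eqxx; split=> //.
      by rewrite ltn_neqAle -ltnS kr andbT -jr eq_sym.
    by have := E'c i ir; rewrite /E' si => /eqP; rewrite subr_eq0 => /eqP ->; field.
  have a0 : a = 0.
    have := ca _ Gg0; rewrite cg0 sub0r => /eqP; rewrite oppr_eq0 mulf_eq0.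
    by move=> /orP[/eqP//|/eqP].
  by have := ca _ Gt; rewrite a0 mul0r subr0.
- exists (g0 :: L); split=> [t /= [<-//|/LG//]|c Phic cL].
  apply: Linj => [|t tL]; last by apply: cL; right.
  by split=> //; apply: cL; left.
Qed.

(** * Cauchy sequences and approximation by sequences *)

Section CauchySequences.
Context {R : realType} {V : normedModType R}.
Implicit Types (u : nat -> V) (y : V).

Definition cauchy_sequence u := forall e : R, 0 < e ->
  exists N, forall n m, (N <= n)%N -> (N <= m)%N -> `|u n - u m| <= e.


Lemma cauchy_sequence_cauchy u : cauchy_sequence u -> cauchy (u @ \oo).
Proof.
move=> cu; apply: cauchy_exP => e e0.
have [N hN] := cu (e / 2) (divr_gt0 e0 (ltr0n _ 2)).
exists (u N); exists N => // n /= Nn; rewrite -ball_normE/=.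
by rewrite (le_lt_trans (hN _ _ _ _))// ltr_pdivrMr// mulr_natr mulr2n ltrDl.
Qed.

Lemma cvg_cauchy_sequence u y : u n @[n --> \oo] --> y -> cauchy_sequence u.
Proof.
move=> /cvgrPdist_le uy e e0; have [N _ hN] := uy (e / 2) (divr_gt0 e0 (ltr0n _ 2)).
exists N => n m Nn Nm; rewrite -[u n](subrK y) -addrA (le_trans (ler_normD _ _))//.
by rewrite [e]splitr lerD// ?hN// distrC hN.
Qed.

Lemma approx_sequence (A : set V) y :
  (forall e, 0 < e -> exists2 w, A w & `|y - w| < e) ->
  exists2 u, (forall n, A (u n)) & u n @[n --> \oo] --> y.
Proof.
move=> hy; have /choice[w /all_and2[Aw yw]] : forall n : nat, exists w,
    A w /\ `|y - w| < n.+1%:R^-1.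
  by move=> n; have [|w] := hy n.+1%:R^-1; [rewrite invr_gt0|exists w].
exists w => //; apply/cvgrPdist_le => e e0; near=> n.
rewrite (le_trans (ltW (yw n)))//.
by apply: ltW; near: n; exact: (near_infty_natSinv_lt (PosNum e0)).
Unshelve. all: end_near. Qed.

End CauchySequences.

Section LinearSpan.
Context {R : realType} {V : normedModType R}.
Implicit Types (l : seq V) (u : nat -> V) (x y v : V).

Fixpoint lin_span l : set V :=
  if l is v :: l' then [set x | exists a w, lin_span l' w /\ x = a *: v + w]
  else [set 0].

Lemma lin_span_comb l a x y : lin_span l x -> lin_span l y ->
  lin_span l (a *: x + y).
Proof.
elim: l x y => [|v l IH] x y /=; first by move=> -> ->; rewrite scaler0 addr0.
move=> [b [w [lw ->]]] [c [z [lz ->]]].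
exists (a * b + c), (a *: w + z); split; first exact: IH.
by rewrite scalerDl scalerDr scalerA addrACA.
Qed.

Lemma lin_span0 l : lin_span l 0.
Proof.
by elim: l => //= v l IH; exists 0, 0; rewrite scale0r addr0.
Qed.

Lemma lin_spanZ l a x : lin_span l x -> lin_span l (a *: x).
Proof.
by move=> lx; rewrite -[X in lin_span _ X]addr0; exact: lin_span_comb (lin_span0 l).
Qed.

Lemma lin_spanD l x y : lin_span l x -> lin_span l y -> lin_span l (x + y).
Proof. by move=> lx ly; rewrite -[x]scale1r; exact: lin_span_comb. Qed.

Lemma lin_spanB l x y : lin_span l x -> lin_span l y -> lin_span l (x - y).
Proof.
by move=> lx ly; apply: lin_spanD => //; rewrite -scaleN1r; exact: lin_spanZ.
Qed.

Lemma lin_span_mem l v : List.In v l -> lin_span l v.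
Proof.
elim: l => //= w l IH [->|/IH lv].
  by exists 1, 0; rewrite scale1r addr0; split=> //; exact: lin_span0.
by exists 0, v; rewrite scale0r add0r.
Qed.

(** Completeness of finite-dimensional subspaces, adding one vector [v] at a time. If [v] is not in
    the span of the others, it has a positive distance [d] from it, and the bound [dle] makes the
    coefficients of [v] a Cauchy sequence. *)
Lemma cauchy_sequence_span_cvg l u : (forall n, lin_span l (u n)) ->
  cauchy_sequence u -> exists y, lin_span l y /\ u n @[n --> \oo] --> y.
Proof.
elim: l u => [|v l IH] u lu cu.
  by exists 0; split=> //; rewrite (_ : u = cst 0); [exact: cvg_cst|exact/funext].
(* The induction hypothesis makes the span of [l] closed; this is why the distance [d] below is
   positive. *)
have lclosed y : (forall e, 0 < e -> exists2 w, lin_span l w & `|y - w| < e) ->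
    lin_span l y.
  move=> /approx_sequence[w lw wy].
  have [z [lz wz]] := IH w lw (cvg_cauchy_sequence _ _ wy).
  by rewrite (cvg_unique _ wy wz).
have [lv|lv] := pselect (lin_span l v).
  have [|y [ly uy]] := IH u _ cu.
    by move=> n; have [a [w [lw ->]]] := lu n; exact: lin_span_comb.
  by exists y; split=> //=; exists 0, y; rewrite scale0r add0r.
have [d d0 hd] : exists2 d : R, 0 < d & forall w, lin_span l w -> d <= `|v - w|.
  apply: contrapT => nd; apply/lv/lclosed => e e0; apply: contrapT => ne.
  apply: nd; exists e => // w lw; rewrite leNgt; apply/negP => vwe.
  by apply: ne; exists w.
have dle a w : lin_span l w -> `|a| * d <= `|a *: v + w|.
  have [->|a0] := eqVneq a 0; first by rewrite normr0 mul0r.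
  move=> lw; rewrite -ler_pdivlMl ?normr_gt0// -normfV -normrZ scalerDr.
  rewrite scalerA mulVf// scale1r -[_ *: w]opprK; apply: hd.
  by rewrite -scaleNr; exact: lin_spanZ.
have /choice[t /choice[w /all_and2[lw ue]]] : forall n, exists a, exists w,
    lin_span l w /\ u n = a *: v + w.
  exact: lu.
have uB n m : u n - u m = (t n - t m) *: v + (w n - w m).
  by rewrite !ue scalerBl opprD addrACA.
have ct : cauchy_sequence t.
  move=> e e0; have [N hN] := cu (e * d) (mulr_gt0 e0 d0).
  exists N => n m Nn Nm; rewrite -(ler_pM2r d0) (le_trans _ (hN n m _ _))//.
  by rewrite uB dle//; exact: lin_spanB.
have [a ta] : exists a : R, t n @[n --> \oo] --> a.
  by apply/cvg_ex; apply: cauchy_cvg; exact: cauchy_sequence_cauchy.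
have cw : cauchy_sequence w.
  have cvgtv : t n *: v @[n --> \oo] --> a *: v by exact: cvgZr_tmp.
  move=> e e0.
  have e20 : 0 < e / 2 by exact: divr_gt0.
  have [N hN] := cu _ e20; have [M hM] := cvg_cauchy_sequence _ _ cvgtv _ e20.
  exists (maxn N M) => n m; rewrite !geq_max => /andP[Nn Mn] /andP[Nm Mm].
  have -> : w n - w m = (u n - u m) - (t n *: v - t m *: v).
    by rewrite uB scalerBl addrAC subrr add0r.
  by rewrite (le_trans (ler_normB _ _))// [e]splitr lerD ?hN ?hM.
have [z [lz wz]] := IH w lw cw.
exists (a *: v + z); split; first by exists a, z.
under eq_fun do rewrite ue.
by apply: cvgD => //; exact: cvgZr_tmp.
Qed.

Lemma lin_span_closed l y :
  (forall e, 0 < e -> exists2 w, lin_span l w & `|y - w| < e) -> lin_span l y.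
Proof.
move=> /approx_sequence[w lw wy].
have [z [lz wz]] := cauchy_sequence_span_cvg l w lw (cvg_cauchy_sequence _ _ wy).
by rewrite (cvg_unique _ wy wz).
Qed.

End LinearSpan.

(** * Integrals of bounded functions for a probability measure *)

Section Mean.
Context {d : measure_display} {T : measurableType d} {R : realType}
        {mu : {measure set T -> \bar R}} {D : set T}.
Hypotheses (mD : measurable D) (muD : mu D = 1%E).
Implicit Types (u v : T -> R) (a c : R).

(** For a probability measure this implies integrability, and unlike integrability it is stable
    under products. *)
Definition bounded_measurable (D : set T) u :=
  measurable_fun D u /\ exists c, forall x, D x -> `|u x| <= c.

Lemma bounded_measurable_integrable u :
  bounded_measurable D u -> mu.-integrable D (EFin \o u).
Proof.
move=> [mu_ [c uc]]; apply: measurable_bounded_integrable => //.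
  by rewrite muD ltry.
exists c; split; first exact: num_real.
by move=> y cy x Dx /=; rewrite (le_trans (uc x Dx))// ltW.
Qed.

Lemma bounded_measurable_cst c : bounded_measurable D (cst c).
Proof. by split=> //; exists `|c|. Qed.

Lemma bounded_measurableD u v : bounded_measurable D u -> bounded_measurable D v ->
  bounded_measurable D (fun x => u x + v x).
Proof.
move=> [mu_ [a ua]] [mv [b vb]]; split; first exact: measurable_funD.
by exists (a + b) => x Dx; rewrite (le_trans (ler_normD _ _))// lerD ?ua ?vb.
Qed.

Lemma bounded_measurableM u v : bounded_measurable D u -> bounded_measurable D v ->
  bounded_measurable D (fun x => u x * v x).
Proof.
move=> [mu_ [a ua]] [mv [b vb]]; split; first exact: measurable_funM.
by exists (a * b) => x Dx; rewrite normrM ler_pM ?ua ?vb.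
Qed.

Lemma bounded_measurableZ a u : bounded_measurable D u ->
  bounded_measurable D (fun x => a * u x).
Proof. by move=> bu; apply: bounded_measurableM => //; exact: bounded_measurable_cst. Qed.

Lemma bounded_measurableB u v : bounded_measurable D u -> bounded_measurable D v ->
  bounded_measurable D (fun x => u x - v x).
Proof.
move=> bu bv; have := bounded_measurableD _ _ bu (bounded_measurableZ (-1) _ bv).
by under [X in bounded_measurable D X -> _]eq_fun do rewrite mulN1r.
Qed.

Lemma bounded_measurable_norm u : bounded_measurable D u ->
  bounded_measurable D (fun x => `|u x|).
Proof.
move=> [mu_ [a ua]]; split; first exact: measurableT_comp.
by exists a => x Dx; rewrite normr_id ua.
Qed.

Lemma bounded_measurable_sum {J : Type} (l : seq J) (w : J -> T -> R) :
  (forall j, bounded_measurable D (w j)) ->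
  bounded_measurable D (fun x => \sum_(j <- l) w j x).
Proof.
move=> bw; elim: l => [|j l IH].
  by under eq_fun do rewrite big_nil; exact: bounded_measurable_cst.
by under eq_fun do rewrite big_cons; exact: bounded_measurableD.
Qed.

Notation "\I_ x E" := (\int[mu]_(x in D) E)
  (at level 36, x name, E at level 36, format "\I_ x  E").

Lemma mean_cst c : \I_x c = c.
Proof. by rewrite Rintegral_cst// muD mulr1. Qed.

Lemma eq_mean u v : (forall x, D x -> u x = v x) -> \I_x u x = \I_x v x.
Proof. by move=> uv; apply: eq_Rintegral => x /set_mem; exact: uv. Qed.

Lemma meanD u v : bounded_measurable D u -> bounded_measurable D v ->
  \I_x (u x + v x) = \I_x (u x) + \I_x (v x).
Proof. by move=> *; rewrite RintegralD//; exact: bounded_measurable_integrable. Qed.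

Lemma meanB u v : bounded_measurable D u -> bounded_measurable D v ->
  \I_x (u x - v x) = \I_x (u x) - \I_x (v x).
Proof. by move=> *; rewrite RintegralB//; exact: bounded_measurable_integrable. Qed.

Lemma meanZ a u : bounded_measurable D u -> \I_x (a * u x) = a * \I_x (u x).
Proof. by move=> *; rewrite RintegralZl//; exact: bounded_measurable_integrable. Qed.

Lemma le_mean u v : bounded_measurable D u -> bounded_measurable D v ->
  (forall x, D x -> u x <= v x) -> \I_x (u x) <= \I_x (v x).
Proof. by move=> *; rewrite le_Rintegral//; exact: bounded_measurable_integrable. Qed.

Lemma normr_mean_le u : bounded_measurable D u -> `|\I_x (u x)| <= \I_x `|u x|.
Proof. by move=> *; rewrite le_normr_Rintegral//; exact: bounded_measurable_integrable. Qed.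

Lemma mean_le_cst u c : bounded_measurable D u ->
  (forall x, D x -> u x <= c) -> \I_x (u x) <= c.
Proof.
move=> bu uc; rewrite -[leRHS]mean_cst; apply: le_mean => //.
exact: bounded_measurable_cst.
Qed.

Lemma normr_mean_le_cst u c : bounded_measurable D u ->
  (forall x, D x -> `|u x| <= c) -> `|\I_x (u x)| <= c.
Proof.
move=> bu uc; rewrite (le_trans (normr_mean_le _ bu))// mean_le_cst//.
exact: bounded_measurable_norm.
Qed.

Lemma mean_sum {J : Type} (l : seq J) (w : J -> T -> R) :
  (forall j, bounded_measurable D (w j)) ->
  \I_x (\sum_(j <- l) w j x) = \sum_(j <- l) \I_x (w j x).
Proof.
move=> bw; elim: l => [|j l IH].
  by under eq_mean do rewrite big_nil; rewrite big_nil mean_cst.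
under eq_mean do rewrite big_cons.
by rewrite big_cons meanD ?IH//; exact: bounded_measurable_sum.
Qed.

(** The mean of [(u x + t * v x) ^+ 2] is a nonnegative quadratic polynomial in [t]; it is evaluated
    at its minimum [- b / c]. *)
Lemma mean_cauchy_schwarz u v : bounded_measurable D u -> bounded_measurable D v ->
  (\I_x (u x * v x)) ^+ 2 <= \I_x (u x ^+ 2) * \I_x (v x ^+ 2).
Proof.
move=> bu bv; set a := \I_x (u x ^+ 2); set b := \I_x _; set c := \I_x (v x ^+ 2).
have buu : bounded_measurable D (fun x => u x ^+ 2) by exact: bounded_measurableM.
have bvv : bounded_measurable D (fun x => v x ^+ 2) by exact: bounded_measurableM.
have buv : bounded_measurable D (fun x => u x * v x) by exact: bounded_measurableM.
have c0 : 0 <= c by apply: Rintegral_ge0 => x _; exact: sqr_ge0.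
have a0 : 0 <= a by apply: Rintegral_ge0 => x _; exact: sqr_ge0.
have quad t : 0 <= a + t * (2 * b) + t ^+ 2 * c.
  have -> : a + t * (2 * b) + t ^+ 2 * c = \I_x ((u x + t * v x) ^+ 2).
    rewrite /a /b /c -!meanZ//; last exact: bounded_measurableZ.
    rewrite -!meanD//; first last.
    - by do 2 apply: bounded_measurableZ.
    - exact: bounded_measurableZ.
    - by apply: bounded_measurableD => //; do 2 apply: bounded_measurableZ.
    by apply: eq_mean => x _; ring.
  by apply: Rintegral_ge0 => x _; exact: sqr_ge0.
have [c_eq0|c_neq0] := eqVneq c 0; last first.
  have c_gt0 : 0 < c by rewrite lt_neqAle eq_sym c_neq0.
  have := quad (- b / c).
  have -> : a + - b / c * (2 * b) + (- b / c) ^+ 2 * c = (a * c - b ^+ 2) / c by field.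
  by rewrite pmulr_lge0 ?invr_gt0// subr_ge0.
(* For [c = 0] the polynomial is affine; if [b] were nonzero, it would take the value -1 at
   [- (a + 1) / (2 * b)]. *)
rewrite c_eq0 mulr0; have [->|b0] := eqVneq b 0; first by rewrite expr0n.
have := quad (- (a + 1) / (2 * b)); rewrite c_eq0 mulr0 addr0.
by rewrite divfK ?mulf_neq0// => h; lra.
Qed.

End Mean.

(** * Means of simple functions *)

Section SimpleMean.
Context {d : measure_display} {T : measurableType d} {R : realType}
        {V : normedModType R} {mu : {measure set T -> \bar R}} {D : set T}.
Hypotheses (mD : measurable D) (muD : mu D = 1%E).
Variables (s : T -> V) (ss : simple_function s).

(** The sum is finite, so measurability and boundedness pass from the functions [F v] to
    [F (s x) x], with no sigma-algebra on [V]. *)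
Lemma simple_compE (F : V -> T -> R) x :
  F (s x) x = \sum_(v <- fset_set (range s)) \1_(s @^-1` [set v]) x * F v x.
Proof.
have sx : s x \in fset_set (range s).
  by rewrite in_fset_set; [apply/mem_set; exists x|case: ss].
rewrite (bigD1_seq (s x)) ?fset_uniq//=.
rewrite indicE mem_set//= mul1r big1 ?addr0// => v vs.
by rewrite indicE memNset ?mul0r// => /= sxv; rewrite sxv eqxx in vs.
Qed.

Lemma bounded_measurable_indic A : measurable A ->
  bounded_measurable D (\1_A : T -> R).
Proof.
move=> mA; split; first exact: measurable_indic.
by exists 1 => x _; rewrite indicE; case: (_ \in _); rewrite ?normr1 ?normr0.
Qed.

Lemma bounded_measurable_simple_comp (F : V -> T -> R) :
  (forall v, bounded_measurable D (F v)) ->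
  bounded_measurable D (fun x => F (s x) x).
Proof.
move=> bF; under eq_fun do rewrite simple_compE.
apply: bounded_measurable_sum => v; apply: bounded_measurableM => //.
by apply: bounded_measurable_indic; case: ss.
Qed.

Lemma mean_simple_comp (a : V -> R) :
  \int[mu]_(x in D) a (s x) =
  \sum_(v <- fset_set (range s)) fine (mu (D `&` s @^-1` [set v])) * a v.
Proof.
rewrite (eq_mean _ _ (fun x _ => simple_compE (fun v => cst (a v)) x)).
have mfib v : measurable (s @^-1` [set v]) by case: ss.
rewrite mean_sum//; last first.
  move=> v; apply: bounded_measurableM; last exact: bounded_measurable_cst.
  exact: bounded_measurable_indic.
apply: eq_bigr => v _; under eq_mean do rewrite /= mulrC.
rewrite meanZ//; last exact: bounded_measurable_indic.
by rewrite mulrC /Rintegral integral_indic// setIC.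
Qed.

(** Reduces vector-valued integrals to scalar ones: later estimates and identities for them are
    tested on functionals. *)
Lemma simple_integral_functional (phi : V -> R) : scalar phi ->
  phi (simple_integral mu D s) = \int[mu]_(x in D) phi (s x).
Proof.
move=> lphi; rewrite mean_simple_comp /simple_integral fsbig_finite//=; last by case: ss.
have phi0 : phi 0 = 0 by have := lphi (-1) 0 0; rewrite scaler0 addr0 mulN1r addNr.
elim: (finmap.enum_fset _) => [|v l IH]; first by rewrite !big_nil.
by rewrite !big_cons lphi IH.
Qed.

End SimpleMean.

(** * Compact groups of isometries *)

Section OperatorNorm.
Context {R : realType} {X : normedModType R}.
Implicit Types g h s t : 'L(X).

Lemma clin_compDl s t h : clin_comp (s + t) h = clin_comp s h + clin_comp t h.
Proof. exact: val_inj. Qed.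

Lemma clin_compZl a s h : clin_comp (a *: s) h = a *: clin_comp s h.
Proof. exact: val_inj. Qed.

Lemma clin_compBr s t h : clin_comp h (s - t) = clin_comp h s - clin_comp h t.
Proof. by apply/val_inj/funext => x /=; exact: linearB. Qed.

Lemma clin_comp1 s : clin_comp s clin_id = s.
Proof. exact: val_inj. Qed.

Lemma normr_clin_apply s x : `|s x| <= `|s| * `|x|.
Proof. exact: le_opnorm. Qed.

Lemma normr_clin_le s c : 0 <= c -> (forall x, `|s x| <= c * `|x|) -> `|s| <= c.
Proof.
move=> c0 sc; apply: opnorm_le => x x1.
by rewrite (le_trans (sc x))// ler_piMr.
Qed.

Lemma normr_clin_comp s t : `|clin_comp s t| <= `|s| * `|t|.
Proof.
apply: normr_clin_le => [|x]; first by rewrite mulr_ge0.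
by rewrite (le_trans (normr_clin_apply s _))// -mulrA ler_wpM2l// normr_clin_apply.
Qed.

Definition lipschitzian {V W : normedModType R} (u : V -> W) :=
  exists2 k : R, 0 <= k & forall x y, `|u x - u y| <= k * `|x - y|.

Lemma lipschitzian_continuous {V W : normedModType R} (u : V -> W) :
  lipschitzian u -> continuous u.
Proof.
move=> [k k0 uk] x; apply/cvgrPdist_le => e e0.
have k1 : 0 < k + 1 by rewrite ltr_wpDl.
near=> y; rewrite (le_trans (uk x y))//.
rewrite (@le_trans _ _ ((k + 1) * `|x - y|)) ?ler_wpM2r ?lerDl//.
rewrite -ler_pdivlMl//; near: y.
by apply: cvgr_dist_le; [exact: cvg_id|rewrite mulr_gt0 ?invr_gt0].
Unshelve. all: end_near. Qed.

Lemma open_measurable_clin (A : set 'L(X)) : open A -> measurable A.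
Proof. exact: sub_sigma_algebra. Qed.

Lemma continuous_measurable_clin (u : 'L(X) -> R) :
  continuous u -> measurable_fun setT u.
Proof.
move=> /continuousP cu; apply: (measurability _ (RGenOpens.measurableE R)).
move=> _ [_ [a [b ->] <-]]; rewrite setTI; apply: open_measurable_clin.
exact/cu/interval_open.
Qed.

Lemma continuous_measurable_clin_clin (u : 'L(X) -> 'L(X)) :
  continuous u -> measurable_fun setT u.
Proof.
move=> /continuousP cu; apply: (@measurability _ _ _ _ setT u (@open 'L(X)) erefl).
by move=> _ [A oA <-]; rewrite setTI; apply: open_measurable_clin; exact: cu.
Qed.

End OperatorNorm.

Section CompactIsometryGroup.
Context {R : realType} {X : normedModType R} {G : set 'L(X)}.
Hypotheses (hG : isometry_group G) (cG : compact G).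
Implicit Types g h s t : 'L(X).

Let compG g h : G g -> G h -> G (clin_comp g h).
Proof. by case: hG => _ + _ _; apply. Qed.

Lemma isometry_group_norm g : G g -> forall x, `|g x| = `|x|.
Proof.
move=> Gg x; have := isometry_group_dist hG Gg x 0.
by rewrite linear0 !subr0.
Qed.

Lemma isometry_group_normr_le1 g : G g -> `|g| <= 1.
Proof.
by move=> Gg; apply: normr_clin_le => // x; rewrite mul1r isometry_group_norm.
Qed.

(** Left translations by [G] thus preserve distances in L(X), whence their continuity and the
    invariance of [bump]. *)
Lemma isometry_group_comp_norm g s : G g -> `|clin_comp g s| = `|s|.
Proof.
move=> Gg; apply/eqP; rewrite eq_le; apply/andP; split.
  rewrite (le_trans (normr_clin_comp _ _))// ler_piMl//.
  exact: isometry_group_normr_le1.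
apply: normr_clin_le => // x; rewrite -(isometry_group_norm _ Gg (s x)).
exact: (normr_clin_apply (clin_comp g s)).
Qed.

Lemma compact_group_measurable : measurable G.
Proof.
have cl : closed G by apply: compact_closed cG; exact: norm_hausdorff.
rewrite -[G]setCK; apply: measurableC; apply: open_measurable_clin.
exact: closed_openC.
Qed.

Lemma lipschitzian_bounded_measurable (u : 'L(X) -> R) :
  lipschitzian u -> bounded_measurable G u.
Proof.
move=> lu; split.
  apply: measurable_funTS; apply: continuous_measurable_clin.
  exact: lipschitzian_continuous.
have [k k0 uk] := lu; exists (`|u 0| + k) => g Gg.
rewrite -[u g](subrK (u 0)) addrC (le_trans (ler_normD _ _))// lerD2l.
by rewrite (le_trans (uk _ _))// subr0 ler_piMr// isometry_group_normr_le1.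
Qed.

Lemma compact_group_net e : 0 < e -> exists l : seq 'L(X),
  (forall p, p \in l -> G p) /\
  forall g, G g -> exists2 p, p \in l & `|g - p| < e.
Proof.
move=> e0; have := cG; rewrite compact_cover => /(_ _ G (fun p => ball p e)).
case=> [p _|g Gg|l lG lcov].
- exact: ball_open.
- by exists g => //; exact: ballxx.
- exists l; split=> [p /lG /set_mem//|g /lcov[p pl]].
  by rewrite -ball_normE/= distrC => pg; exists p.
Qed.

(** Each [g] is sent to the first point of a finite net at distance less than [e]. *)
Lemma simple_approx e : 0 < e -> exists s : 'L(X) -> 'L(X),
  [/\ simple_function s, forall g, G (s g) & forall g, G g -> `|g - s g| < e].
Proof.
move=> e0; have [l [lG lnet]] := compact_group_net e e0.
(* The default [clin_id] keeps the values in [G] also at points far from the net. *)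
pose fix pick (l : seq 'L(X)) g {struct l} :=
  if l is p :: l' then if `|g - p| < e then p else pick l' g else clin_id.
have mB p : measurable [set g : 'L(X) | `|g - p| < e].
  rewrite (_ : [set _ | _] = ball p e).
    by apply: open_measurable_clin; exact: ball_open.
  by rewrite -ball_normE; apply/seteqP; split=> g /=; rewrite distrC.
exists (pick l); split.
- elim: (l) => [|p l' [fin mea]].
    split.
      by apply: (@sub_finite_set _ _ [set clin_id]) => // _ [g _ <-].
    move=> v; rewrite (_ : _ @^-1` _ = if clin_id == v then setT else set0).
      by case: ifP => _; [exact: measurableT|exact: measurable0].
    by case: eqVneq => [<-|/eqP nv]; apply/seteqP; split.
  split.
    apply: (@sub_finite_set _ _ (p |` range (pick l'))); last first.
      by rewrite finite_setU; split.
    by move=> _ [g _ <-] /=; case: ifP => _; [left|right; exists g].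
  move=> v; rewrite (_ : _ @^-1` _ =
      ([set g | `|g - p| < e] `&` [set _ | p = v]) `|`
      (~` [set g | `|g - p| < e] `&` (pick l' @^-1` [set v]))).
    apply: measurableU; apply: measurableI => //; last exact: measurableC.
    rewrite (_ : [set _ | _] = if p == v then setT else set0).
      by case: ifP => _; [exact: measurableT|exact: measurable0].
    by case: eqVneq => [->|/eqP nv]; apply/seteqP; split.
  apply/seteqP; split=> g /=.
    by case: ifPn => [gp pv|/negP gp pv]; [left|right].
  by case: ifPn => [gp [[]//|[]//]|/negP gp [[]//|[]//]].
- move=> g; elim: (l) lG => [|p l' IH] lG /=.
    by case: hG.
  case: ifP => _; first by apply: lG; rewrite inE eqxx.
  by apply: IH => q ql; apply: lG; rewrite inE ql orbT.
- move=> g /lnet[p pl gp]; elim: (l) pl => //= q l' IH.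
  by rewrite inE => /predU1P[pq|/IH]; case: ifPn => //; rewrite -pq gp.
Qed.

Context {mu : {measure set 'L(X) -> \bar R}}.
Hypothesis hmu : normalized_haar G mu.

(** Passes from invariance of the measure of sets to invariance of integrals by a change of
    variables along [clin_comp g]. *)
Lemma mean_translate g (u : 'L(X) -> R) : G g ->
  measurable_fun setT u -> bounded_measurable G u ->
  \int[mu]_(h in G) u (clin_comp g h) = \int[mu]_(h in G) u h.
Proof.
move=> Gg mu_ bu; have [g' [Gg' gg' g'g]] := isometry_group_inv hG Gg.
have gK : cancel (clin_comp g) (clin_comp g').
  by move=> h; apply/val_inj/funext => x /=; have /(congr1 (fun t => t (h x))) := g'g.
have g'K : cancel (clin_comp g') (clin_comp g).
  by move=> h; apply/val_inj/funext => x /=; have /(congr1 (fun t => t (h x))) := gg'.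
have mg : measurable_fun setT (clin_comp g).
  apply: continuous_measurable_clin_clin.
  apply: lipschitzian_continuous; exists 1 => // s t.
  by rewrite -clin_compBr isometry_group_comp_norm// mul1r.
have preG : clin_comp g @^-1` G = G.
  apply/seteqP; split=> h /= Gh; last exact: compG.
  by rewrite -(gK h); exact: compG.
have bug : bounded_measurable G (fun h => u (clin_comp g h)).
  split; first by apply: measurable_funTS; exact: measurableT_comp.
  by have [c uc] := bu.2; exists c => h Gh; apply/uc/compG.
have mG := compact_group_measurable.
rewrite /Rintegral; congr fine.
(* The pushforward agrees with [mu] on measurable subsets of [G], since the preimage of [A] is its
   translate by the inverse [g']. *)
rewrite [RHS](eq_measure_integral (pushforward mu (clin_comp g))); last first.
  move=> A mA AG; transitivity (mu (clin_comp g @^-1` A)); last by [].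
  rewrite -(hmu.2 g' A Gg' mA AG); congr (mu _).
  apply/seteqP; split=> [_ [h Ah <-]|h Ah] /=; first by rewrite g'K.
  by exists (clin_comp g h).
rewrite [RHS]integral_pushforward//.
- by rewrite preG.
- exact/measurable_EFinP.
- by rewrite preG; apply: bounded_measurable_integrable => //; exact: hmu.1.
Qed.

End CompactIsometryGroup.

(** * Averages of functionals over a neighbourhood of the identity *)

Section BoundedFunctional.
Context {R : realType} {V : normedModType R}.
Implicit Types (phi psi : V -> R) (c : R).

(** The bound [c] is explicit because its geometric decay under iteration is used. *)
Definition bounded_functional c phi :=
  [/\ 0 <= c, scalar phi & forall x, `|phi x| <= c * `|x|].

Lemma scalarB phi : scalar phi -> forall x y, phi (x - y) = phi x - phi y.
Proof.
by move=> lphi x y; rewrite addrC -scaleN1r lphi mulN1r addrC.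
Qed.

Lemma scalarN phi : scalar phi -> forall x, phi (- x) = - phi x.
Proof.
move=> lphi x; have phi0 : phi 0 = 0 by rewrite -(subrr 0) scalarB// subrr.
by rewrite -[- x]add0r scalarB// phi0 sub0r.
Qed.

Lemma bounded_functional_lipschitz c phi :
  bounded_functional c phi -> lipschitzian phi.
Proof. by move=> [c0 lphi phic]; exists c => // x y; rewrite -scalarB. Qed.

Lemma bounded_functional_comb c phi b psi a : bounded_functional c phi ->
  bounded_functional b psi ->
  bounded_functional (c + `|a| * b) (fun x => phi x - a * psi x).
Proof.
move=> [c0 lphi phic] [b0 lpsi psib]; split.
- by rewrite addr_ge0// mulr_ge0.
- by move=> k x y /=; rewrite lphi lpsi; ring.
- move=> x; rewrite (le_trans (ler_normB _ _))// mulrDl lerD// normrM -mulrA.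
  by rewrite ler_wpM2l.
Qed.

End BoundedFunctional.

(** Log-convexity makes the successive ratios nondecreasing. If the first ratio [r] exceeded [q],
    then [a n] would be at least [r ^+ n * a 0], which outgrows [c * q ^+ n]. *)
Lemma log_convex_geometric {R : realType} (a : nat -> R) (q c : R) : 0 < q ->
  (forall n, 0 <= a n) -> (forall n, a n.+1 ^+ 2 <= a n * a n.+2) ->
  (forall n, a n <= c * q ^+ n) -> a 1%N <= q * a 0%N.
Proof.
move=> q0 a0 alog aq; rewrite leNgt; apply/negP => a1.
have a00 : 0 < a 0%N.
  rewrite lt_neqAle a0 andbT; apply/negP => /eqP a00.
  have := alog 0%N; rewrite -a00 mul0r real_exprn_even_le0 ?num_real// => /eqP a10.
  by move: a1; rewrite a10 -a00 mulr0 ltxx.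
pose r := a 1%N / a 0%N.
have qr : q < r by rewrite /r ltr_pdivlMr.
have r0 : 0 < r by rewrite (lt_trans q0).
have step n : 0 < a n /\ r * a n <= a n.+1.
  elim: n => [|n [an0 IH]]; first by rewrite /r divfK ?gt_eqF.
  have an1 : 0 < a n.+1 by rewrite (lt_le_trans _ IH)// mulr_gt0.
  split=> //; rewrite -(ler_pM2l an0) (le_trans _ (alog n))// expr2 mulrCA mulrA.
  by rewrite ler_wpM2r// ltW.
have geo n : r ^+ n * a 0%N <= a n.
  elim: n => [|n IH]; first by rewrite mul1r.
  by rewrite exprS -mulrA (le_trans _ (step n).2)// ler_wpM2l// ltW.
pose x := r / q - 1.
have x0 : 0 < x by rewrite subr_gt0 ltr_pdivlMr// mul1r.
(* Bernoulli's inequality, which shows that the powers of [r / q] are unbounded. *)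
have bern n : 1 + n%:R * x <= (r / q) ^+ n.
  elim: n => [|n IH]; first by rewrite mul0r addr0 expr0.
  have -> : r / q = 1 + x by rewrite /x addrC subrK.
  have xn : 0 <= n%:R * x by rewrite mulr_ge0// ltW.
  rewrite exprS [r / q](_ : _ = 1 + x) in IH *; last by rewrite /x addrC subrK.
  rewrite (@le_trans _ _ ((1 + x) * (1 + n%:R * x)))//; last first.
    by rewrite ler_wpM2l// addr_ge0// ltW.
  by rewrite -natr1; nra.
have bnd n : 1 + n%:R * x <= c / a 0%N.
  rewrite (le_trans (bern n))// ler_pdivlMr// expr_div_n mulrAC ler_pdivrMr ?exprn_gt0//.
  exact: le_trans (geo n) (aq n).
have : 0 <= c / a 0%N / x.
  by rewrite divr_ge0 ?(ltW x0)//; have := bnd 0%N; rewrite mul0r; lra.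
move=> /archi_boundP; set n := Num.bound _.
rewrite ltr_pdivrMr// => h; have := bnd n; lra.
Qed.

(** * Convolution with a tent function on the group *)

Section ConvolutionKernel.
Context {R : realType} {X : normedModType R} {G : set 'L(X)}
        {mu : {measure set 'L(X) -> \bar R}}.
Hypotheses (hG : isometry_group G) (cG : compact G) (hmu : normalized_haar G mu).
Implicit Types (g h s t : 'L(X)) (phi psi : 'L(X) -> R).

Let mG : measurable G := compact_group_measurable cG.
Let muG : mu G = 1%E := hmu.1.
Let bmL := lipschitzian_bounded_measurable hG.

Notation "\I_ x E" := (\int[mu]_(x in G) E)
  (at level 36, x name, E at level 36, format "\I_ x  E").

(* Fubini for uniformly continuous integrands, by Riemann sums; the measurability
   of [w] for the product sigma-algebra would be a problem as L(X) need not be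
   separable. *)
Lemma mean_exchange (w : 'L(X) -> 'L(X) -> R) (k : R) :
  (forall g, bounded_measurable G (w g)) ->
  (forall h, bounded_measurable G (w^~ h)) ->
  bounded_measurable G (fun g => \I_h (w g h)) ->
  bounded_measurable G (fun h => \I_g (w g h)) ->
  (forall g h h', G g -> G h -> G h' -> `|w g h - w g h'| <= k * `|h - h'|) ->
  \I_g (\I_h (w g h)) = \I_h (\I_g (w g h)).
Proof.
move=> bw1 bw2 bI1 bI2 wk; apply/eqP; rewrite -subr_eq0 -normr_le0.
apply/ler_addgt0Pr => e e0; rewrite add0r.
have k1 : 0 < `|k| + 1 by rewrite ltr_wpDl.
have d0 : 0 < e / 2 / (`|k| + 1) by rewrite divr_gt0// divr_gt0.
have [s [ss Gs sd]] := simple_approx hG cG _ d0.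
have ws g h : G g -> G h -> `|w g h - w g (s h)| <= e / 2.
  move=> Gg Gh; rewrite (le_trans (wk _ _ _ Gg Gh (Gs h)))//.
  rewrite (@le_trans _ _ ((`|k| + 1) * `|h - s h|))//.
    by rewrite ler_wpM2r// (le_trans (ler_norm k))// lerDl.
  by rewrite mulrC -ler_pdivlMr// ltW// sd.
pose c v := fine (mu (G `&` s @^-1` [set v])).
(* A Riemann sum for the inner integral over [h]. For it the exchange is linearity, and each
   iterated integral is within [e / 2] of its mean. *)
pose S g := \sum_(v <- fset_set (range s)) c v * w g v.
have SE g : S g = \I_h (w g (s h)).
  by rewrite (mean_simple_comp mG muG s ss).
have bS : bounded_measurable G S.
  by apply: bounded_measurable_sum => v; apply: bounded_measurableZ; exact: bw2.
have bs (F : 'L(X) -> R) : bounded_measurable G (fun h => F (s h)).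
  apply: (bounded_measurable_simple_comp s ss (fun v => cst (F v))) => v.
  exact: bounded_measurable_cst.
have h1 : `|\I_g (\I_h (w g h)) - \I_g (S g)| <= e / 2.
  rewrite -meanB//; apply: normr_mean_le_cst => //.
    exact: bounded_measurableB.
  move=> g Gg; rewrite SE -meanB//; apply: normr_mean_le_cst => //.
    exact: bounded_measurableB.
  by move=> h Gh; exact: ws.
have h2 : `|\I_h (\I_g (w g h)) - \I_g (S g)| <= e / 2.
  have -> : \I_g (S g) = \I_h (\I_g (w g (s h))).
    rewrite (mean_simple_comp mG muG s ss (fun v => \I_g (w g v))) /S.
    rewrite mean_sum//; first by apply: eq_bigr => v _; rewrite meanZ.
    by move=> v; exact: bounded_measurableZ.
  have bIs := bs (fun v => \I_g (w g v)).
  rewrite -meanB//; apply: normr_mean_le_cst => //.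
    exact: bounded_measurableB.
  move=> h Gh; rewrite -meanB//; apply: normr_mean_le_cst => //.
    exact: bounded_measurableB.
  by move=> g Gg; exact: ws.
by rewrite [e]splitr (le_trans (ler_distD (\I_g (S g)) _ _))// lerD// distrC.
Qed.

Variable (e : R).
Hypothesis e0 : 0 < e.

(** A tent around [g]: being a function of the distance, it is symmetric, 1-Lipschitz and invariant
    under left translations by [G]. *)
Definition bump g h : R := Num.max (e - `|g - h|) 0.

Lemma bump_ge0 g h : 0 <= bump g h.
Proof. by rewrite le_max lexx orbT. Qed.

Lemma bump_le g h : bump g h <= e.
Proof. by rewrite ge_max (ltW e0) andbT lerBlDr lerDl. Qed.

Lemma bumpC g h : bump g h = bump h g.
Proof. by rewrite /bump distrC. Qed.

Lemma bump_eq0 g h : e <= `|g - h| -> bump g h = 0.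
Proof. by move=> gh; apply/max_idPr; rewrite subr_le0. Qed.

Lemma bump_dist g g' h : `|bump g h - bump g' h| <= `|g - g'|.
Proof.
have le g1 g2 : bump g1 h <= bump g2 h + `|g1 - g2|.
  rewrite ge_max addr_ge0 ?bump_ge0// andbT.
  have : e - `|g2 - h| <= bump g2 h by rewrite le_max lexx.
  have := ler_distD g1 g2 h; rewrite (distrC g2 g1); lra.
by rewrite ler_norml; have := le g g'; have := le g' g; rewrite (distrC g' g); lra.
Qed.

Lemma bump_distr g h h' : `|bump g h - bump g h'| <= `|h - h'|.
Proof. by rewrite ![bump g _]bumpC bump_dist. Qed.

Lemma bump_translate g h : G g -> bump g (clin_comp g h) = bump clin_id h.
Proof.
move=> Gg; rewrite /bump -{1}(clin_comp1 g) -clin_compBr.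
by rewrite (isometry_group_comp_norm hG).
Qed.

Lemma bump_lipschitz g : lipschitzian (bump g).
Proof. by exists 1 => // h h'; rewrite mul1r bump_distr. Qed.

Lemma bounded_measurable_bump g : bounded_measurable G (bump g).
Proof. exact/bmL/bump_lipschitz. Qed.

Definition bump_mass := \I_h (bump clin_id h).

Lemma mean_bump g : G g -> \I_h (bump g h) = bump_mass.
Proof.
move=> Gg; rewrite -(mean_translate hG cG hmu g)//.
- by apply: eq_Rintegral => h _; rewrite bump_translate.
- by apply: continuous_measurable_clin; apply/lipschitzian_continuous/bump_lipschitz.
- exact: bounded_measurable_bump.
Qed.

(** The tents around a finite net of mesh [e / 2] have a sum of at least [e / 2] on [G], and by
    invariance they all have the same mean. *)
Lemma bump_mass_gt0 : 0 < bump_mass.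
Proof.
have e20 : 0 < e / 2 by rewrite divr_gt0.
have [l [lG lnet]] := compact_group_net cG _ e20.
have : e / 2 <= \I_h (\sum_(p <- l) bump p h).
  rewrite -[leLHS](mean_cst mG muG); apply: le_mean => //.
  - exact: bounded_measurable_cst.
  - by apply: bounded_measurable_sum => p; exact: bounded_measurable_bump.
  move=> h /lnet[p pl hp]; rewrite (big_rem p pl)/= -[leLHS]addr0 lerD//.
    by rewrite le_max distrC lerBrDr -lerBrDl; apply/orP; left; lra.
  by apply: sumr_ge0 => *; exact: bump_ge0.
rewrite mean_sum//; last exact: bounded_measurable_bump.
rewrite big_seq (eq_bigr (fun=> bump_mass)) => [|p pl]; last exact: mean_bump (lG _ pl).
rewrite -big_seq big_const_seq count_predT iter_addr_0 => h.
rewrite ltNge; apply/negP => m0.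
by have := lt_le_trans e20 h; rewrite ltNge (mulrn_wle0 _ m0).
Qed.

Definition kernel g h := bump g h / bump_mass.

Let m0 : 0 < bump_mass := bump_mass_gt0.

Lemma kernel_ge0 g h : 0 <= kernel g h.
Proof. by rewrite divr_ge0 ?bump_ge0 ?ltW. Qed.

Lemma kernelC g h : kernel g h = kernel h g.
Proof. by rewrite /kernel bumpC. Qed.

Lemma kernel_le g h : `|kernel g h| <= e / bump_mass.
Proof. by rewrite ger0_norm ?kernel_ge0// ler_pM2r ?invr_gt0// bump_le. Qed.

Lemma kernel_dist g g' h : `|kernel g h - kernel g' h| <= `|g - g'| / bump_mass.
Proof.
have im0 : 0 <= bump_mass^-1 by rewrite invr_ge0 ltW.
by rewrite -mulrBl normrM (ger0_norm im0) ler_wpM2r// bump_dist.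
Qed.

Lemma kernel_distr g h h' : `|kernel g h - kernel g h'| <= `|h - h'| / bump_mass.
Proof. by rewrite ![kernel g _]kernelC kernel_dist. Qed.

Lemma kernel_lipschitz g : lipschitzian (kernel g).
Proof.
exists bump_mass^-1 => [|h h']; first by rewrite invr_ge0 ltW.
by rewrite mulrC kernel_distr.
Qed.

Lemma bounded_measurable_kernel g : bounded_measurable G (kernel g).
Proof. exact/bmL/kernel_lipschitz. Qed.

Lemma mean_kernel : \I_h (kernel clin_id h) = 1.
Proof.
under eq_Rintegral do rewrite /kernel mulrC.
rewrite meanZ//; last exact: bounded_measurable_bump.
by rewrite mulVf// gt_eqF.
Qed.

(** [kernel clin_id] is a probability density supported in the [e]-ball around the identity. *)
Lemma mean_kernel_le (x : 'L(X) -> R) (b : R) : bounded_measurable G x ->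
  (forall h, G h -> `|clin_id - h| < e -> `|x h| <= b) ->
  `|\I_h (kernel clin_id h * x h)| <= b.
Proof.
move=> bx xb; have bk := bounded_measurable_kernel clin_id.
have bkx := bounded_measurableM _ _ bk bx.
rewrite (le_trans (normr_mean_le mG muG _ bkx))//.
have -> : b = \I_h (b * kernel clin_id h) by rewrite meanZ// mean_kernel mulr1.
apply: le_mean => //; first exact: bounded_measurable_norm.
  exact: bounded_measurableZ.
move=> h Gh; rewrite normrM ger0_norm ?kernel_ge0// mulrC.
have [hid|hid] := ltP `|clin_id - h| e.
  by rewrite ler_wpM2r ?kernel_ge0// xb.
by rewrite /kernel bump_eq0// mul0r !mulr0.
Qed.

(** Two forms of one operator: [kernel_op] has a symmetric kernel, which gives self-adjointness,
    while [average_op] is defined on all of L(X) and preserves linearity. They agree on [G]. *)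
Definition kernel_op phi g := \I_h (kernel g h * phi h).

Definition average_op phi s := \I_h (kernel clin_id h * phi (clin_comp s h)).

Lemma bounded_functional_measurable c phi :
  bounded_functional c phi -> bounded_measurable G phi.
Proof. by move=> /bounded_functional_lipschitz/bmL. Qed.

Lemma bounded_measurable_translate c phi s : bounded_functional c phi ->
  bounded_measurable G (fun h => phi (clin_comp s h)).
Proof.
move=> [c0 lphi phic]; apply: bmL; exists (c * `|s|) => [|h h']; first exact: mulr_ge0.
rewrite -scalarB// -clin_compBr (le_trans (phic _))// -mulrA ler_wpM2l//.
exact: normr_clin_comp.
Qed.

Lemma bounded_measurable_kernelM g u : bounded_measurable G u ->
  bounded_measurable G (fun h => kernel g h * u h).
Proof.
by move=> bu; apply: bounded_measurableM => //; exact: bounded_measurable_kernel.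
Qed.

Lemma normr_clin_comp_isometry s h : G h -> `|clin_comp s h| <= `|s|.
Proof.
move=> Gh; rewrite (le_trans (normr_clin_comp _ _))// ler_piMr//.
exact: isometry_group_normr_le1 hG _ Gh.
Qed.

Lemma average_op_scalar c phi : bounded_functional c phi -> scalar (average_op phi).
Proof.
move=> bphi a s t; have [_ lphi _] := bphi.
have bp r := bounded_measurable_kernelM clin_id _
  (bounded_measurable_translate _ _ r bphi).
rewrite /average_op -meanZ// -meanD//; last exact: bounded_measurableZ.
by apply: eq_Rintegral => h _; rewrite clin_compDl clin_compZl lphi; ring.
Qed.

Lemma average_op_bounded c phi :
  bounded_functional c phi -> bounded_functional c (average_op phi).
Proof.
move=> bphi; have [c0 lphi phic] := bphi; split=> //.
  exact: average_op_scalar bphi.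
move=> s; apply: mean_kernel_le => [|h Gh _].
  exact: bounded_measurable_translate bphi.
by rewrite (le_trans (phic _))// ler_wpM2l// normr_clin_comp_isometry.
Qed.

(** The difference averages [phi] at [s] composed with [clin_id - h], and [clin_id - h] has norm
    less than [e] on the support of the kernel. *)
Lemma average_op_close c phi : bounded_functional c phi ->
  bounded_functional (e * c) (fun s => phi s - average_op phi s).
Proof.
move=> bphi; have [c0 lphi phic] := bphi; split; first by rewrite mulr_ge0// ltW.
  move=> a s t; rewrite lphi (average_op_scalar _ _ bphi); ring.
move=> s.
have bs := bounded_measurable_translate _ _ s bphi.
have -> : phi s - average_op phi s =
    \I_h (kernel clin_id h * (phi s - phi (clin_comp s h))).
  rewrite -[phi s in LHS]mulr1 -mean_kernel -meanZ//; last first.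
    exact: bounded_measurable_kernel.
  rewrite -meanB//; last exact: bounded_measurable_kernelM.
    by apply: eq_Rintegral => h _; ring.
  by apply: bounded_measurableZ; exact: bounded_measurable_kernel.
apply: mean_kernel_le => [|h Gh hid].
  by apply: bounded_measurableB => //; exact: bounded_measurable_cst.
rewrite -scalarB// -{1}(clin_comp1 s) -clin_compBr (le_trans (phic _))//.
rewrite [e * c]mulrC -mulrA ler_wpM2l// [e * _]mulrC.
by rewrite (le_trans (normr_clin_comp _ _))// ler_wpM2l// ltW.
Qed.

(** Substitute [clin_comp g h] for [h]; the kernel is invariant under this translation. *)
Lemma average_opE c phi g : bounded_functional c phi -> G g ->
  average_op phi g = kernel_op phi g.
Proof.
move=> bphi Gg; rewrite /kernel_op.
rewrite -(mean_translate hG cG hmu g (fun h => kernel g h * phi h) Gg).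
- by apply: eq_Rintegral => h _; rewrite /kernel bump_translate.
- apply: measurable_funM; apply: continuous_measurable_clin;
    apply: lipschitzian_continuous.
    exact: kernel_lipschitz.
  exact: bounded_functional_lipschitz bphi.
- by apply: bounded_measurable_kernelM; exact: bounded_functional_measurable bphi.
Qed.

Lemma kernel_op_lipschitz c phi : bounded_functional c phi ->
  lipschitzian (kernel_op phi).
Proof.
move=> bphi; have [c0 _ phic] := bphi.
have bk g := bounded_measurable_kernelM g _ (bounded_functional_measurable _ _ bphi).
exists (bump_mass^-1 * c) => [|g g']; first by rewrite mulr_ge0// invr_ge0 ltW.
rewrite /kernel_op -meanB//; apply: normr_mean_le_cst => //.
  exact: bounded_measurableB.
move=> h Gh; rewrite -mulrBl normrM mulrAC ler_pM//.
  by rewrite mulrC kernel_dist.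
by rewrite (le_trans (phic _))// ler_piMr// (isometry_group_normr_le1 hG).
Qed.

Lemma kernel_op_selfadjoint c phi b psi :
  bounded_functional c phi -> bounded_functional b psi ->
  \I_g (kernel_op phi g * psi g) = \I_g (phi g * kernel_op psi g).
Proof.
move=> bphi bpsi; have [c0 lphi phic] := bphi; have [b0 lpsi psib] := bpsi.
have mphi := bounded_functional_measurable _ _ bphi.
have mpsi := bounded_functional_measurable _ _ bpsi.
have mk g := bounded_measurable_kernelM g.
have mKphi := bmL _ (kernel_op_lipschitz _ _ bphi).
have mKpsi := bmL _ (kernel_op_lipschitz _ _ bpsi).
have le1 h : G h -> `|phi h| <= c.
  by move=> Gh; rewrite (le_trans (phic _))// ler_piMr// (isometry_group_normr_le1 hG).
have le2 h : G h -> `|psi h| <= b.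
  by move=> Gh; rewrite (le_trans (psib _))// ler_piMr// (isometry_group_normr_le1 hG).
pose w g h := psi g * (kernel g h * phi h).
have wE1 g : \I_h (w g h) = psi g * kernel_op phi g by rewrite meanZ//; exact: mk.
have wE2 h : \I_g (w g h) = phi h * kernel_op psi h.
  rewrite /kernel_op -meanZ//; last exact: mk.
  by apply: eq_Rintegral => g _; rewrite /w kernelC; ring.
have -> : \I_g (kernel_op phi g * psi g) = \I_g (\I_h (w g h)).
  by apply: eq_Rintegral => g _; rewrite wE1 mulrC.
(* The Lipschitz constant of [w g] on [G]: [b] bounds [psi], and the two summands come from varying
   the kernel and [phi] in their product. *)
rewrite (mean_exchange w (b * (bump_mass^-1 * c + e / bump_mass * c))).
- by apply: eq_Rintegral => g _; rewrite wE2.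
- by move=> g; apply: bounded_measurableZ; exact: mk.
- move=> h; have := bounded_measurableZ (phi h) _ (mk h psi mpsi).
  by congr bounded_measurable; apply/funext => g; rewrite /w kernelC; ring.
- by under eq_fun do rewrite wE1; exact: bounded_measurableM.
- by under eq_fun do rewrite wE2; exact: bounded_measurableM.
move=> g h h' Gg Gh Gh'; rewrite -mulrBr normrM -mulrA ler_pM ?le2//.
have -> : kernel g h * phi h - kernel g h' * phi h' =
  (kernel g h - kernel g h') * phi h + kernel g h' * (phi h - phi h') by ring.
rewrite (le_trans (ler_normD _ _))// !normrM mulrDl lerD//.
  rewrite mulrAC ler_pM ?le1// mulrC; exact: kernel_distr.
rewrite -[leRHS]mulrA ler_pM//; first by rewrite -normrM; exact: kernel_le.
by rewrite -scalarB.
Qed.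

Lemma average_op_sqr_le c phi : bounded_functional c phi ->
  \I_g ((phi g - average_op phi g) ^+ 2) <= e ^+ 2 * \I_g (phi g ^+ 2).
Proof.
move=> bphi.
pose D psi : 'L(X) -> R := fun s => psi s - average_op psi s.
have bD n : bounded_functional (e ^+ n * c) (iter n D phi).
  elim: n => [|n IH]; first by rewrite expr0 mul1r.
  by rewrite exprS -mulrA; exact: average_op_close.
have mD n : bounded_measurable G (iter n D phi).
  exact: bounded_functional_measurable (bD n).
pose a n := \I_g (iter n D phi g ^+ 2).
(* The [a n] are squared norms, hence the squares of [e] and [c]. *)
apply: (log_convex_geometric a (e ^+ 2) (c ^+ 2)) => [||n|n].
- exact: exprn_gt0.
- by move=> n; apply: Rintegral_ge0 => *; exact: sqr_ge0.
(* One factor [D] is moved across the inner product by self-adjointness; Cauchy-Schwarz then gives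
   log-convexity. *)
- have -> : a n.+1 = \I_g (iter n D phi g * iter n.+2 D phi g).
    have mK m := bmL _ (kernel_op_lipschitz _ _ (bD m)).
    transitivity (\I_g (iter n D phi g * iter n.+1 D phi g) -
                  \I_g (kernel_op (iter n D phi) g * iter n.+1 D phi g)).
      rewrite -meanB//; [|exact: bounded_measurableM..].
      apply: eq_Rintegral => g /set_mem Gg.
      by rewrite [in LHS]/= -!(average_opE _ _ _ (bD n) Gg) /= /D; ring.
    rewrite (kernel_op_selfadjoint _ _ _ _ (bD n) (bD n.+1)).
    rewrite -meanB//; [|exact: bounded_measurableM..].
    apply: eq_Rintegral => g /set_mem Gg.
    by rewrite -(average_opE _ _ _ (bD n.+1) Gg) -mulrBr.
  exact: mean_cauchy_schwarz.
- rewrite -exprM mulnC exprM -exprMn mulrC /a; apply: mean_le_cst => //.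
    exact: bounded_measurableM.
  move=> g Gg; have [cn0 _ le] := bD n.
  rewrite -real_normK ?num_real// ler_pXn2r// ?nnegrE//.
  by rewrite (le_trans (le g))// ler_piMr// (isometry_group_normr_le1 hG).
Qed.

End ConvolutionKernel.

(** * Finite-dimensionality of the span of the group *)

Section Separation.
Context {R : realType} {V : normedModType R}.
Implicit Types (y : V) (l : seq V).

Lemma norming_functional y : exists phi : V -> R,
  [/\ bounded_functional 1 phi, forall x, phi x <= `|x| & phi y = `|y|].
Proof.
have [|phi [lphi phile phiy]] := hahn_banach (fun x : V => `|x|) y.
  by split=> [|a x a0]; [exact: ler_normD|rewrite normrZ ger0_norm].
exists phi; split=> //; split=> // x; rewrite mul1r ler_norml phile andbT.
by rewrite lerNl -scalarN// -normrN.
Qed.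

(** Hahn-Banach for the distance [p] to the span gives a bounded functional that vanishes on the
    span and equals [p y] at [y]. Hence [p y = 0], and the span is closed. *)
Lemma mem_lin_span l y :
  (forall c phi, bounded_functional c phi ->
    (forall v, List.In v l -> phi v = 0) -> phi y = 0) -> lin_span l y.
Proof.
move=> hy; pose A x := [set `|x - w| | w in lin_span l]; pose p x := inf (A x).
have A0 x : A x !=set0 by exists `|x - 0|, 0 => //; exact: lin_span0.
have ple x w : lin_span l w -> p x <= `|x - w|.
  move=> lw; apply: ge_inf; last by exists w.
  by exists 0 => _ [? _ <-].
have p0 w : lin_span l w -> p w <= 0.
  by move=> lw; rewrite (le_trans (ple _ _ lw))// subrr normr0.
have [|phi [lphi phile phiy]] := hahn_banach p y.
  apply: sublinear_le; first exact/p0/lin_span0.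
  - move=> x x'; apply: le_infD => // _ _ [w lw <-] [w' lw' <-].
    apply: (le_trans (ple _ _ (lin_spanD _ _ _ lw lw'))).
    by rewrite opprD addrACA ler_normD.
  - move=> a x a0; rewrite -ler_pdivrMl//; apply: lb_le_inf => // _ [w lw <-].
    rewrite ler_pdivrMl//; apply: (le_trans (ple _ _ (lin_spanZ _ a _ lw))).
    by rewrite -scalerBr normrZ gtr0_norm.
have phi0 w : lin_span l w -> phi w = 0.
  move=> lw; apply/eqP; rewrite eq_le (le_trans (phile w)) ?p0//=.
  rewrite -oppr_le0 -scalarN// (le_trans (phile _))// p0//.
  by rewrite -scaleN1r; exact: lin_spanZ.
have bphi : bounded_functional 1 phi.
  have phi_le x : phi x <= `|x|.
    by rewrite (le_trans (phile x))// (le_trans (ple x 0 _)) ?subr0//; exact: lin_span0.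
  split=> // x; rewrite mul1r ler_norml phi_le andbT lerNl -scalarN// -normrN.
  exact: phi_le.
have py0 : p y = 0.
  by rewrite -phiy; apply: hy bphi _ => v lv; exact/phi0/lin_span_mem.
apply: lin_span_closed => e e0.
have [|_ [w lw <-]] := @inf_adherent _ (A y) e e0.
  by split=> //; exists 0 => _ [? _ <-].
by rewrite -/(p y) py0 add0r; exists w.
Qed.

End Separation.

Section GroupSpan.
Context {R : realType} {X : normedModType R} {G : set 'L(X)}
        {mu : {measure set 'L(X) -> \bar R}}.
Hypotheses (hG : isometry_group G) (cG : compact G) (hmu : normalized_haar G mu).
Implicit Types (g h s t : 'L(X)) (phi psi : 'L(X) -> R).

Let mG : measurable G := compact_group_measurable cG.
Let muG : mu G = 1%E := hmu.1.

(** By Cauchy-Schwarz the averages of [phi] vanish on [G] at every scale [e], and there they differ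
    from [phi] by at most [e * c], which is arbitrarily small. *)
Lemma mean_square_eq0 c phi : bounded_functional c phi ->
  \int[mu]_(g in G) (phi g ^+ 2) = 0 -> forall g, G g -> phi g = 0.
Proof.
move=> bphi phi0 g Gg; apply/eqP; rewrite -normr_le0.
have [c0 _ _] := bphi.
have c1 : 0 < c + 1 by rewrite ltr_wpDl.
apply/ler_addgt0Pr => d d0; rewrite add0r.
have e0 : 0 < d / (c + 1) by rewrite divr_gt0.
have mphi := bounded_functional_measurable hG _ _ bphi.
set e := d / (c + 1) in e0.
have mk := bounded_measurable_kernel hG cG hmu e e0 g.
have Tphi0 : average_op (G := G) (mu := mu) e phi g = 0.
  rewrite (average_opE hG cG hmu e e0 _ _ _ bphi Gg) /kernel_op.
  have := mean_cauchy_schwarz mG muG _ _ mk mphi.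
  by rewrite phi0 mulr0 real_exprn_even_le0 ?num_real// => /eqP.
have [_ _ /(_ g)] := average_op_close hG cG hmu e e0 _ _ bphi.
rewrite Tphi0 subr0 => /le_trans; apply.
rewrite (@le_trans _ _ (e * c))//.
  by apply: ler_piMr (isometry_group_normr_le1 hG _ Gg); rewrite mulr_ge0// ltW.
by rewrite /e mulrAC ler_pdivrMr// ler_pM2l// lerDl.
Qed.

Lemma average_op_net : exists l : seq 'L(X), (forall p, p \in l -> G p) /\
  forall c phi, bounded_functional c phi ->
    (forall p, p \in l -> average_op (G := G) (mu := mu) (4^-1) phi p = 0) ->
    forall g, G g -> phi g = 0.
Proof.
have e0 : 0 < 4^-1 :> R by rewrite invr_gt0.
set e : R := 4^-1 in e0 *.
have m0 := bump_mass_gt0 hG cG hmu e e0.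
set m := bump_mass e in m0.
(* The kernel has Lipschitz constant [m^-1], so moving to a net point changes it by at most [e]. *)
have [l [lG lnet]] := compact_group_net cG (e * m) (mulr_gt0 e0 m0).
exists l; split=> // c phi bphi phil; apply: (mean_square_eq0 _ _ bphi).
set a := \int[mu]_(g in G) _.
have a0 : 0 <= a by apply: Rintegral_ge0 => *; exact: sqr_ge0.
have mphi := bounded_functional_measurable hG _ _ bphi.
have mphi2 : bounded_measurable G (fun g => phi g ^+ 2) by exact: bounded_measurableM.
have mk := bounded_measurable_kernel hG cG hmu e e0.
set k := kernel e in mk.
pose T := average_op (G := G) (mu := mu) e phi.
have bT : bounded_functional c T by exact: average_op_bounded.
have bD := average_op_close hG cG hmu e e0 _ _ bphi.
have mT := bounded_functional_measurable hG _ _ bT.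
have mD := bounded_functional_measurable hG _ _ bD.
have Tle g : G g -> T g ^+ 2 <= e ^+ 2 * a.
  move=> Gg; have [p pl gp] := lnet g Gg.
  have Gp := lG p pl.
  have mB : bounded_measurable G (fun h => k g h - k p h).
    exact: bounded_measurableB.
  have -> : T g = \int[mu]_(h in G) ((k g h - k p h) * phi h).
    rewrite -[LHS]subr0 -(phil p pl) /T.
    rewrite !(average_opE hG cG hmu e e0 _ _ _ bphi)// /kernel_op.
    rewrite -meanB//; [|exact: bounded_measurableM..].
    by apply: eq_Rintegral => h _; rewrite mulrBl.
  rewrite (le_trans (mean_cauchy_schwarz mG muG _ _ mB mphi))// ler_wpM2r//.
  apply: mean_le_cst => // [|h Gh]; first exact: bounded_measurableM.
  rewrite -real_normK ?num_real// ler_pXn2r// ?nnegrE ?(ltW e0)//.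
  rewrite (le_trans (kernel_dist hG cG hmu e e0 _ _ _))//.
  by rewrite ler_pdivrMr// ltW.
have IT : \int[mu]_(g in G) (T g ^+ 2) <= e ^+ 2 * a.
  by apply: mean_le_cst => //; exact: bounded_measurableM.
have ID := average_op_sqr_le hG cG hmu e e0 _ _ bphi.
(* From [phi = T + (phi - T)] and the bound of the square of a sum by twice the sum of squares. With
   [e = 4^-1] the right side is [a / 4], so [a = 0]. *)
have : a <= 2 * (e ^+ 2 * a) + 2 * (e ^+ 2 * a).
  rewrite (@le_trans _ _
    (\int[mu]_(g in G) (2 * T g ^+ 2 + 2 * (phi g - T g) ^+ 2)))//.
    apply: le_mean => //.
      by apply: bounded_measurableD; apply: bounded_measurableZ;
        exact: bounded_measurableM.
    move=> g _; have := sqr_ge0 (T g - (phi g - T g)); nra.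
  rewrite meanD//; [|apply: bounded_measurableZ; exact: bounded_measurableM..].
  by rewrite !meanZ//; [|exact: bounded_measurableM..]; rewrite lerD// ler_pM2l.
have -> : e ^+ 2 = 16^-1 by rewrite /e exprVn -natrX.
by move=> h; lra.
Qed.

(* By Hahn-Banach, this says that the elements of [l] span the same subspace of
   L(X) as [G]. *)
Lemma group_functionals_determined : exists l : seq 'L(X),
  (forall t, List.In t l -> G t) /\
  forall c phi, bounded_functional c phi ->
    (forall t, List.In t l -> phi t = 0) -> forall t, G t -> phi t = 0.
Proof.
have [l [lG ldet]] := average_op_net.
have e0 : 0 < 4^-1 :> R by rewrite invr_gt0.
have [|||l' [l'G l'det]] := @finite_determination R _ G (size l)
  [set phi | exists c, bounded_functional c phi]
  (fun j phi => average_op (G := G) (mu := mu) (4^-1) phi (nth clin_id l j)).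
- move=> phi psi a [c bphi] [b bpsi].
  by exists (c + `|a| * b); exact: bounded_functional_comb.
- move=> j phi psi a [c bphi] [b bpsi].
  have mk := bounded_measurable_kernelM hG cG hmu _ e0 clin_id.
  have mphi s := mk _ (bounded_measurable_translate hG _ _ s bphi).
  have mpsi s := mk _ (bounded_measurable_translate hG _ _ s bpsi).
  rewrite /average_op -meanZ// -meanB//; last exact: bounded_measurableZ.
  by apply: eq_Rintegral => h _; ring.
- move=> phi [c bphi] phil; apply: ldet bphi _ => p /(nthP clin_id)[j jl <-].
  exact: phil.
- exists l'; split=> // c phi bphi; apply: l'det.
  by exists c.
Qed.

End GroupSpan.

(** * Averages of orbits *)

Section GroupAverage.
Context {R : realType} {X : normedModType R} {G : set 'L(X)}
        {mu : {measure set 'L(X) -> \bar R}}.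
Hypotheses (hG : isometry_group G) (cG : compact G) (hmu : normalized_haar G mu).
Implicit Types (g h s t : 'L(X)) (x y z : X).

Let mG : measurable G := compact_group_measurable cG.
Let muG : mu G = 1%E := hmu.1.

Lemma bounded_functional_clin c (psi : X -> R) g : bounded_functional c psi ->
  bounded_functional (c * `|g|) (fun x => psi (g x)).
Proof.
move=> [c0 lpsi psic]; split; first exact: mulr_ge0.
- by move=> a x y; rewrite clin_linear lpsi.
- by move=> x; rewrite (le_trans (psic _))// -mulrA ler_wpM2l// normr_clin_apply.
Qed.

Lemma bounded_functional_apply c (psi : X -> R) x : bounded_functional c psi ->
  bounded_functional (c * `|x|) (fun g : 'L(X) => psi (g x)).
Proof.
move=> [c0 lpsi psic]; split; first exact: mulr_ge0.
- by move=> a g h /=; rewrite -lpsi.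
- move=> g; rewrite (le_trans (psic _))// -mulrA ler_wpM2l// mulrC.
  exact: normr_clin_apply.
Qed.

Lemma eq_functional {V : normedModType R} (u v : V) :
  (forall c phi, bounded_functional c phi -> phi u = phi v) -> u = v.
Proof.
move=> uv; apply/eqP; rewrite -subr_eq0 -normr_eq0; apply/eqP.
have [phi [bphi _ <-]] := norming_functional (u - v).
by have [_ lphi _] := bphi; rewrite scalarB// (uv _ _ bphi) subrr.
Qed.

(** The identity holds for the simple approximations, and [psi] changes the L^1 error by a factor of
    at most [c]. *)
Lemma is_bochner_integral_functional x y c (psi : X -> R) :
  is_bochner_integral mu G (fun g : 'L(X) => g x) y ->
  bounded_functional c psi -> psi y = \int[mu]_(g in G) psi (g x).
Proof.
move=> [s [ss ms s0 sy]] bpsi; have [c0 lpsi psic] := bpsi.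
have bx : bounded_measurable G (fun g : 'L(X) => psi (g x)).
  exact: bounded_functional_measurable hG _ _ (bounded_functional_apply _ _ x bpsi).
have bs n : bounded_measurable G (fun g => psi (s n g)).
  apply: (bounded_measurable_simple_comp (s n) (ss n) (fun v => cst (psi v))) => v.
  exact: bounded_measurable_cst.
have bxs n : bounded_measurable G (fun g => `|g x - s n g|).
  split; first exact: ms.
  have [_ [k sk]] : bounded_measurable G (fun g => `|s n g|).
    apply: (bounded_measurable_simple_comp (s n) (ss n) (fun v => cst `|v|)) => v.
    exact: bounded_measurable_cst.
  exists (`|x| + k) => g Gg; rewrite normr_id (le_trans (ler_normB _ _))//.
  by rewrite (isometry_group_norm hG)// lerD2l -[leLHS]normr_id sk.
have psiy : psi (simple_integral mu G (s n)) @[n --> \oo] --> psi y.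
  apply: continuous_cvg => //.
  exact: lipschitzian_continuous (bounded_functional_lipschitz _ _ bpsi) _.
apply: (cvg_unique _ psiy) => //.
apply/cvgrPdist_le => e e0.
have c1 : 0 < c + 1 by rewrite ltr_wpDl.
have sR0 : \int[mu]_(g in G) `|g x - s n g| @[n --> \oo] --> (0 : R).
  exact: fine_cvg.
move/cvgrPdist_le : sR0 => /(_ (e / (c + 1)) (divr_gt0 e0 c1)).
apply: filterS => n; rewrite /= sub0r normrN => sn.
rewrite (simple_integral_functional mG muG _ (ss n) _ lpsi) -meanB//.
rewrite (le_trans (normr_mean_le mG muG _ _))//; first exact: bounded_measurableB.
rewrite (@le_trans _ _ (\int[mu]_(g in G) ((c + 1) * `|g x - s n g|)))//.
  apply: le_mean => //.
  - by apply: bounded_measurable_norm; exact: bounded_measurableB.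
  - exact: bounded_measurableZ.
  - move=> g _; rewrite -scalarB// (le_trans (psic _))// ler_wpM2r// lerDl//.
rewrite meanZ// mulrC -ler_pdivlMr// (le_trans (ler_norm _))//.
Qed.

(** A functional vanishing on [l] vanishes on [G], where [s] takes its values, hence on the
    integral. *)
Lemma lin_span_simple_integral l (s : 'L(X) -> 'L(X)) :
  (forall c phi, bounded_functional c phi ->
    (forall t, List.In t l -> phi t = 0) -> forall t, G t -> phi t = 0) ->
  simple_function s -> (forall g, G (s g)) -> lin_span l (simple_integral mu G s).
Proof.
move=> ldet ss Gs; apply: mem_lin_span => c phi bphi phil.
have [_ lphi _] := bphi.
rewrite (simple_integral_functional mG muG _ ss _ lphi).
rewrite -[RHS](mean_cst mG muG); apply: eq_mean => g _.
exact: ldet bphi phil _ (Gs g).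
Qed.

(** The inclusion of [G] in L(X) is approximated by simple functions. Their integrals [P n] form a
    Cauchy sequence in a finite-dimensional span, so they have a limit [P0] in L(X), and the average
    of [x] is [P0 x]. *)
Lemma is_bochner_integral_orbit x :
  exists y, is_bochner_integral mu G (fun g : 'L(X) => g x) y.
Proof.
have [l [_ ldet]] := group_functionals_determined hG cG hmu.
have /choice[s /all_and3[ss Gs sd]] : forall n, exists s : 'L(X) -> 'L(X),
    [/\ simple_function s, forall g, G (s g) &
        forall g, G g -> `|g - s g| < n.+1%:R^-1].
  by move=> n; apply: simple_approx => //; rewrite invr_gt0.
pose P n := simple_integral mu G (s n).
have bs n (F : 'L(X) -> R) : bounded_measurable G (fun g => F (s n g)).
  apply: (bounded_measurable_simple_comp (s n) (ss n) (fun v => cst (F v))) => v.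
  exact: bounded_measurable_cst.
have PB n m : `|P n - P m| <= n.+1%:R^-1 + m.+1%:R^-1.
  have [phi [bphi phile <-]] := norming_functional (P n - P m).
  have [_ lphi _] := bphi.
  rewrite scalarB// !(simple_integral_functional mG muG _ (ss _) _ lphi) -meanB//.
  apply: mean_le_cst => //; first exact: bounded_measurableB.
  move=> g Gg; rewrite -scalarB// (le_trans (phile _))//.
  rewrite (le_trans (ler_distD g _ _))// lerD// ltW ?sd// distrC sd//.
have cP : cauchy_sequence P.
  move=> e e0; have e20 : 0 < e / 2 by rewrite divr_gt0.
  have [N _ hN] := near_infty_natSinv_lt (PosNum e20).
  exists N => n m Nn Nm; rewrite (le_trans (PB n m))// [e]splitr.
  by rewrite lerD// ltW//; apply: hN.
have [P0 [_ PP0]] := cauchy_sequence_span_cvg l P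
  (fun n => lin_span_simple_integral _ _ ldet (ss n) (Gs n)) cP.
have sxs n : simple_function (fun g => s n g x).
  have [sfin sm] := ss n; split.
    apply: (@sub_finite_set _ _ ((fun t : 'L(X) => t x) @` range (s n))).
      by move=> _ [g _ <-]; exists (s n g) => //; exists g.
    exact: finite_image.
  move=> v; rewrite (_ : _ @^-1` _ =
      \bigcup_(t in range (s n) `&` [set t : 'L(X) | t x = v]) (s n @^-1` [set t])).
    apply: fin_bigcup_measurable => [|t _]; last exact: sm.
    by apply: sub_finite_set sfin => t [].
  apply/seteqP; split=> [g /= <-|g [t [_ /= <-] ->//]].
  by exists (s n g) => //; split=> //; exists g.
have bxs n : bounded_measurable G (fun g : 'L(X) => `|g x - s n g x|).
  apply: (bounded_measurable_simple_comp (s n) (ss n)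
    (fun (t g : 'L(X)) => `|g x - t x|)) => t.
  apply: lipschitzian_bounded_measurable => //; exists `|x| => // g h.
  rewrite (le_trans (ler_dist_dist _ _))// opprB addrA subrK mulrC.
  exact: (normr_clin_apply (g - h)).
exists (P0 x), (fun n g => s n g x); split=> //.
- by move=> n; case: (bxs n).
- rewrite (_ : (fun n => _) =
      EFin \o (fun n => \int[mu]_(g in G) `|g x - s n g x|)); last first.
    apply/funext => n; rewrite /= /Rintegral fineK//; apply: integrable_fin_num => //.
    exact: bounded_measurable_integrable mG muG _ (bxs n).
  apply: cvg_EFin; first exact: nearW.
  apply/cvgrPdist_le => e e0.
  have x1 : 0 < `|x| + 1 by rewrite ltr_wpDl.
  have e'0 : 0 < e / (`|x| + 1) by rewrite divr_gt0.
  have [N _ hN] := near_infty_natSinv_lt (PosNum e'0).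
  exists N => // n Nn; rewrite /= sub0r normrN; apply: normr_mean_le_cst => // g Gg.
  rewrite normr_id (le_trans (normr_clin_apply (g - s n g) x))//.
  rewrite (@le_trans _ _ (e / (`|x| + 1) * `|x|))//.
    by rewrite ler_wpM2r// ltW// (lt_trans (sd n g Gg))//; exact: hN.
  by rewrite mulrAC ler_pdivrMr// ler_pM2l// lerDl.
(* Different values of [s n] may agree at [x], so the two sums have different index sets;
   functionals avoid regrouping them. *)
- have -> : (fun n => simple_integral mu G (fun g => s n g x)) = (fun n => P n x).
    apply/funext => n; apply: eq_functional => c psi bpsi.
    have [_ lpsi _] := bpsi.
    have [_ lx _] := bounded_functional_apply _ _ x bpsi.
    rewrite (simple_integral_functional mG muG _ (sxs n) _ lpsi).
    by rewrite (simple_integral_functional mG muG _ (ss n) _ lx).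
  have cx : continuous (fun t : 'L(X) => t x : X).
    apply: lipschitzian_continuous; exists `|x| => // g h.
    by rewrite mulrC; exact: (normr_clin_apply (g - h)).
  exact: cvg_comp PP0 (cx P0).
Qed.

(** The choice made by [get] is resolved here; the properties of the average below rest on this
    identity. *)
Lemma group_average_functional x c (psi : X -> R) : bounded_functional c psi ->
  psi (group_average G mu x) = \int[mu]_(g in G) psi (g x).
Proof.
move=> bpsi; apply: is_bochner_integral_functional bpsi.
exact: getPex (is_bochner_integral_orbit x).
Qed.

Lemma group_average_fixed x : group_average G mu x \in fixed_pred G.
Proof.
apply/asboolP => h Gh; apply: eq_functional => c psi bpsi.
have bh := bounded_functional_clin _ _ h bpsi.
rewrite (group_average_functional x _ _ bh) (group_average_functional x _ _ bpsi).
have bx := bounded_functional_apply _ _ x bpsi.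
apply: (mean_translate hG cG hmu h (fun g : 'L(X) => psi (g x)) Gh).
- apply: continuous_measurable_clin; apply: lipschitzian_continuous.
  exact: bounded_functional_lipschitz bx.
- exact: bounded_functional_measurable hG _ _ bx.
Qed.

(** A norming functional of the difference reduces this to [|g x - z| = |g x - g z| = |x - z|] under
    the mean. *)
Lemma group_average_dist x z : z \in fixed_pred G ->
  `|group_average G mu x - z| <= `|x - z|.
Proof.
move=> /asboolP zG.
have [psi [bpsi psile <-]] := norming_functional (group_average G mu x - z).
have [_ lpsi _] := bpsi.
have bx := bounded_functional_measurable hG _ _ (bounded_functional_apply _ _ x bpsi).
rewrite scalarB// (group_average_functional x _ _ bpsi) lerBlDr.
apply: mean_le_cst => // g Gg; rewrite -lerBlDr -scalarB//.
rewrite (le_trans (psile _))// -{1}(zG g Gg).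
by rewrite (isometry_group_dist hG Gg).
Qed.

End GroupAverage.

(** * Ekeland's principle *)

(** Starting from [v], each step goes to a point of [S (u n)] with nearly minimal [f]. The values
    decrease to a limit, which forces the points to be Cauchy; their limit is minimal for the order
    given by [S]. *)
Lemma ekeland {R : realType} {V : normedModType R} (f : V -> R) (e : R) (v : V) :
  banach V -> lipschitzian f -> has_lbound (range f) -> 0 < e ->
  exists x0, f x0 <= f v /\ forall x, f x0 <= f x + e * `|x - x0|.
Proof.
move=> bV lf [m fm] e0.
have fcont := lipschitzian_continuous _ lf.
pose S x := [set y | f y + e * `|x - y| <= f x].
have Sxx x : S x x by rewrite /S/= subrr normr0 mulr0 addr0.
have Strans x y z : S x y -> S y z -> S x z.
  rewrite /S/= => xy yz; have := ler_wpM2l (ltW e0) (ler_distD y x z); lra.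
have Sle x y : S x y -> f y <= f x.
  by move=> xy; rewrite (le_trans _ xy)// lerDl mulr_ge0// ltW.
(* The condition says that [f y] is at most midway between [f x] and the infimum of [f] over
   [S x]. *)
have /choice[next /all_and2[Snext nextle]] : forall x, exists y, S x y /\
    forall z, S x z -> 2 * f y <= f x + f z.
  move=> x; pose A := f @` S x.
  have Alb : has_lbound A by exists m => _ [y _ <-]; apply: fm; exists y.
  have Ainf z : S x z -> inf A <= f z by move=> xz; apply: ge_inf => //; exists z.
  have [fx|fx] := leP (f x) (inf A).
    by exists x; split=> // z /Ainf; lra.
  have d0 : 0 < (f x - inf A) / 2 by rewrite divr_gt0// subr_gt0.
  have [|_ [y xy <-] fy] := @inf_adherent _ A _ d0.
    by split=> //; exists (f x), x.
  by exists y; split=> // z /Ainf; lra.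
pose u n := iter n next v.
have Su n k : S (u n) (u (n + k)%N).
  elim: k => [|k IH]; first by rewrite addn0.
  by rewrite addnS; apply: (Strans _ _ _ IH); exact: Snext.
have Sum n k : (n <= k)%N -> S (u n) (u k) by move=> /subnKC <-.
have [l fl] : exists l : R, f (u n) @[n --> \oo] --> l.
  apply/cvg_ex; apply: nonincreasing_is_cvgn.
    by move=> n k nk; apply: Sle; exact: Sum.
  by exists m => _ [n _ <-]; apply: fm; exists (u n).
have cu : cauchy_sequence u.
  move=> d d0; have [N hN] := cvg_cauchy_sequence _ _ fl (e * d) (mulr_gt0 e0 d0).
  have main n k : (N <= n)%N -> (n <= k)%N -> `|u n - u k| <= d.
    move=> Nn nk; rewrite -(ler_pM2l e0) (le_trans _ (hN n k Nn (leq_trans Nn nk)))//.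
    rewrite (le_trans _ (ler_norm _))// lerBrDl; exact: Sum.
  exists N => n k Nn Nk; have [nk|/ltnW kn] := leqP n k; first exact: main.
  by rewrite distrC; exact: main.
have /cvg_ex[x0 ux0] : cvg (u n @[n --> \oo]).
  by apply: bV; exact: cauchy_sequence_cauchy.
have fux0 : f (u n) @[n --> \oo] --> f x0 by apply: cvg_comp ux0 (fcont x0).
have Sx0 n : S (u n) x0.
  rewrite /S/=; apply: (@ler_cvg_to _ \oo _ _
    (fun k => f (u k) + e * `|u n - u k|) (fun=> f (u n))).
  - apply: cvgD => //. apply: cvgM; first exact: cvg_cst.
    by apply: cvg_norm; apply: cvgB => //; exact: cvg_cst.
  - exact: cvg_cst.
  - by exists n => // k /= nk; exact: Sum.
exists x0; split; first exact: Sle _ _ (Sx0 0%N).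
move=> z; rewrite leNgt; apply/negP => zlt.
have Sz : S x0 z by rewrite /S/= distrC ltW.
have fz : f z < f x0 by rewrite (le_lt_trans _ zlt)// lerDl mulr_ge0// ltW.
(* By transitivity [z] lies in every [S (u n)], so [nextle] can be passed to the limit. *)
have : 2 * f x0 <= f x0 + f z.
  apply: (@ler_cvg_to _ \oo _ _ (fun n => 2 * f (u n.+1)) (fun n => f (u n) + f z)).
  - apply: cvgM; first exact: cvg_cst.
    by rewrite (cvg_shiftS (fun n => f (u n))).
  - by apply: cvgD => //; exact: cvg_cst.
  - by apply: nearW => n; apply: nextle; apply: Strans Sz.
lra.
Qed.

(** * Completeness of the fixed space *)

Section CompletenessOfFixedSpace.
Context {R : realType} {X : normedModType R} {G : set 'L(X)}
        {mu : {measure set 'L(X) -> \bar R}}.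
Hypotheses (hG : isometry_group G) (cG : compact G) (hmu : normalized_haar G mu).

(** For invariant [f], convexity with respect to [G] thus says that averaging does not increase
    [f]. *)
Lemma mean_invariant (f : X -> R) x : invariant_under G f ->
  \int[mu]_(g in G) f ((g : 'L(X)) x) = f x.
Proof.
move=> invf; rewrite -[RHS](mean_cst (compact_group_measurable cG) hmu.1).
by apply: eq_Rintegral => g /set_mem Gg; rewrite invf.
Qed.

Lemma ekeland_of_banach (f : X -> R) (e : R) : banach (fixed_space G) ->
  has_lbound (range f) -> lipschitzian f -> invariant_under G f ->
  convex_wrt G mu f -> 0 < e ->
  exists x0 : X, [/\ x0 \in fixed_pred G, f x0 <= inf (range f) + e &
    forall x : X, f x0 <= f x + e * `|x - x0|].
Proof.
move=> bG lbf [k k0 kf] invf convf e0.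
pose av x : fixed_space G := FixedSpace (group_average_fixed hG cG hmu x).
have fav x : f (av x) <= f x by rewrite -[leRHS](mean_invariant f x invf); exact: convf.
have [|_ [v _ <-] fv] := @inf_adherent _ (range f) e e0.
  by split=> //; exists (f 0), 0.
(* Starting at the average of the near-minimizer [v] yields the bound by the infimum. *)
have [||x0 [x0v x0le]] := ekeland (fun y : fixed_space G => f y) e (av v) bG _ _ e0.
- by exists k => // x y; exact: kf.
- by have [m fm] := lbf; exists m => _ [y _ <-]; apply: fm; exists (fixed_val y).
exists (fixed_val x0); split; first exact: fixed_valP.
- by rewrite (le_trans x0v)// (le_trans (fav v))// ltW.
- move=> x; rewrite (le_trans (x0le (av x)))// lerD// ler_pM2l//.
  exact: (group_average_dist hG cG hmu x (fixed_val x0) (fixed_valP x0)).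
Qed.

Lemma banach_of_ekeland :
  (forall f : X -> R, has_lbound (range f) -> (exists k : R, k.-lipschitz f) ->
    invariant_under G f -> convex_wrt G mu f ->
    forall e : R, 0 < e -> exists x0 : X, x0 \in fixed_pred G /\
      forall x : X, x != x0 -> f x0 <= f x + e * `|x - x0|) ->
  banach (fixed_space G).
Proof.
move=> hek F PF cF.
(* The distance to [x] is 1-Lipschitz, so it maps [F] to a Cauchy filter on the complete field
   [R]. *)
have /choice[d dP] : forall x : X, exists a : R,
    `|x - fixed_val y| @[y --> F] --> a.
  move=> x; apply/cvg_ex; apply: cauchy_cvg; apply: cauchy_exP => e e0.
  have [y Fy] := (cauchyP F).1 cF e e0.
  exists `|x - fixed_val y|; apply: (@filterS _ F _ (ball y e)) Fy => z yz.
  have {}yz : `|fixed_val y - fixed_val z| < e by move: yz; rewrite -ball_normE.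
  rewrite -ball_normE/= (le_lt_trans (ler_dist_dist _ _))//.
  by rewrite opprB addrC addrA subrK distrC.
have d0 x : 0 <= d x.
  by apply: (ler_cvg_to (cvg_cst 0) (dP x)); apply: nearW => y.
have dle (x x' : X) (c : R) :
    (forall y : fixed_space G, `|x - fixed_val y| <= `|x' - fixed_val y| + c) ->
    d x <= d x' + c.
  move=> xx'; apply: (ler_cvg_to (dP x) (cvgD (dP x') (cvg_cst c))).
  by apply: nearW => y; exact: xx'.
have dlip (x x' : X) : d x <= d x' + `|x - x'|.
  by apply: dle => y; rewrite [leRHS]addrC ler_distD.
have invd : invariant_under G d.
  move=> g x Gg.
  have gx : (fun y : fixed_space G => `|g x - fixed_val y|) =
            (fun y => `|x - fixed_val y|).
    apply/funext => y; have /asboolP yG := fixed_valP y.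
    by rewrite -{1}(yG g Gg) (isometry_group_dist hG Gg).
  by have := dP (g x); rewrite gx => dgx; exact: cvg_unique dgx (dP x).
have [||||x0 [x0G x0le]] := hek d _ _ invd _ 2^-1.
- by exists 0 => _ [x _ <-].
- exists 1 => -[x x'] _ /=; rewrite mul1r ler_norml.
  have := dlip x x'; have := dlip x' x; rewrite (distrC x' x); lra.
- move=> x; rewrite mean_invariant// -[leRHS]addr0; apply: dle => y.
  by rewrite addr0; exact: group_average_dist (fixed_valP y).
- by rewrite invr_gt0.
have {}x0le x : d x0 <= d x + 2^-1 * `|x - x0|.
  by have [->|/x0le//] := eqVneq x x0; rewrite subrr normr0 mulr0 addr0.
(* Points [y] far along [F] have [d y <= e / 2], as [F] is Cauchy. Passing to the limit in [x0le y]
   gives [d x0 <= e / 2 + d x0 / 2], that is, [d x0 <= e]. *)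
have dx0 : d x0 = 0.
  apply/eqP; rewrite eq_le d0 andbT; apply/ler_addgt0Pr => e e0; rewrite add0r.
  have e20 : 0 < e / 2 by rewrite divr_gt0.
  have [y0 Fy0] := (cauchyP F).1 cF (e / 2 / 2) (divr_gt0 e20 (ltr0n _ 2)).
  have Fd : \forall y \near F, d (fixed_val y) <= e / 2.
    apply: filterS (Fy0) => y y0y.
    apply: (ler_cvg_to (dP y) (cvg_cst (e / 2))).
    apply: filterS Fy0 => z y0z; move: y0y y0z; rewrite -!ball_normE/=.
    move=> y0y y0z; have : `|fixed_val y0 - fixed_val y| < e / 2 / 2 by exact: y0y.
    have : `|fixed_val y0 - fixed_val z| < e / 2 / 2 by exact: y0z.
    have := ler_distD (fixed_val y0) (fixed_val y) (fixed_val z).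
    rewrite (distrC (fixed_val y) (fixed_val y0)); lra.
  have : d x0 <= e / 2 + 2^-1 * d x0.
    apply: (@ler_cvg_to _ F _ _ (fun=> d x0)
      (fun y => e / 2 + 2^-1 * `|x0 - fixed_val y|)); first exact: cvg_cst.
      by apply: cvgD; [exact: cvg_cst|apply: cvgM; [exact: cvg_cst|exact: dP]].
    apply: filterS Fd => y dy; rewrite (le_trans (x0le y))//.
    by rewrite lerD// (distrC x0).
  lra.
apply/cvg_ex; exists (FixedSpace x0G); apply/cvgrPdist_le => e e0.
have := dP x0; rewrite dx0 => /cvgrPdist_le/(_ e e0); apply: filterS => y.
by rewrite sub0r normrN normr_id.
Qed.

End CompletenessOfFixedSpace.

Theorem theorem19 (R : realType) (X : normedModType R) (G : set 'L(X))
    (mu : {measure set 'L(X) -> \bar R})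
    (hG : isometry_group G) (cG : compact G) (hmu : normalized_haar G mu) :
  banach (fixed_space G) <->
  forall f : X -> R,
    has_lbound (range f) -> (exists k : R, k.-lipschitz f) ->
    invariant_under G f -> convex_wrt G mu f ->
    forall eps : R, 0 < eps ->
    exists x0 : X, [/\ x0 \in fixed_pred G,
      f x0 <= inf (range f) + eps &
      forall x : X, x != x0 -> f x0 <= f x + eps * `|x - x0|].
Proof.
split=> [bG f lbf [k kf] invf convf eps eps0|hek].
  have lf : lipschitzian f.
    (* The given constant [k] may be negative. *)
    exists `|k| => // x y; rewrite (le_trans (kf (x, y) _))//=.
    by rewrite ler_wpM2r// ler_norm.
  have [x0 [x0G x0inf x0le]] :=
    ekeland_of_banach hG cG hmu f eps bG lbf lf invf convf eps0.
  by exists x0.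
apply: (banach_of_ekeland hG cG hmu) => f lbf kf invf convf e e0.
by have [x0 [x0G _ x0le]] := hek f lbf kf invf convf e e0; exists x0.
Qed.
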